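(* Let $N\geq 2$ be an integer and let $\Gamma \leq \mathrm{Diff}_{+}(I)$ be an irreducible subgroup such that every non-identity element of $\Gamma$ has at most $N$ fixed points in $(0,1)$. Then every non-identity element of $\Gamma$ has at most one fixed point in $(0,1)$.
   Context: $I=[0,1]$; $\mathrm{Diff}_{+}(I)$ is the group of orientation preserving $C^1$ diffeomorphisms of $I$. A subgroup of $\mathrm{Homeo}_+(I)$ is irreducible if it has no global fixed point in $(0,1)$. *)

(* Defs.v *)
From mathcomp Require Import all_boot all_order all_algebra.
From mathcomp Require Import all_classical all_reals all_analysis.

Set Implicit Arguments.
Unset Strict Implicit.
Unset Printing Implicit Defensive.

Import Order.TTheory GRing.Theory Num.Theory.
Import numFieldNormedType.Exports.

Local Open Scope classical_set_scope.
Local Open Scope ring_scope.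

(* Through the coercion of sets to types, [unit_itv R] is also the type of
   points of [0, 1], with the topology induced from R: its self-maps are equal
   exactly when they agree on [0, 1], and limits at the endpoints are
   one-sided. *)
Definition unit_itv (R : realType) : set R := `[0, 1].
Arguments unit_itv : clear implicits.

Section DiffI.
Variable R : realType.
Local Notation I := (unit_itv R).
Implicit Types (f g : I -> I) (x y : I).

Definition pt x : R := val x.

Definition interior_pt x : Prop := 0 < pt x < 1.

Definition has_deriv f x (l : R) : Prop :=
  (pt (f y) - pt (f x)) / (pt y - pt x) @[y --> x^'] --> l.

Definition C1 f : Prop :=
  exists2 df : I -> R, continuous df & forall x, has_deriv f x (df x).

Definition mutually_inverse f g : Prop := cancel f g /\ cancel g f.

Definition C1_diffeo f : Prop :=
  C1 f /\ exists2 g, mutually_inverse f g & C1 g.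

Definition orientation_preserving f : Prop :=
  forall x y, pt x < pt y -> pt (f x) < pt (f y).

Definition Diff_plus : set (I -> I) :=
  [set f | C1_diffeo f /\ orientation_preserving f].

Definition subgroup_Diff_plus (Gamma : set (I -> I)) : Prop :=
  [/\ Gamma `<=` Diff_plus,
      Gamma id,
      forall f g, Gamma f -> Gamma g -> Gamma (f \o g) &
      forall f, Gamma f -> exists2 g, Gamma g & mutually_inverse f g].

Definition irreducible (Gamma : set (I -> I)) : Prop :=
  ~ exists2 x, interior_pt x & forall f, Gamma f -> f x = x.

Definition interior_fixpoints f : set I :=
  [set x | interior_pt x /\ f x = x].

End DiffI.

(* Main.v *)
(** An element [f] with a fixed point and a suitable conjugate of it play
    ping-pong, so two conjugate elements [u], [v] generate a free semigroup. By
    the C^1 hypothesis both contract near 0 at nearly the same rate, and the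
    pigeonhole principle applied to the 2^n words of length n yields
    non-identity elements arbitrarily close to the identity.

    Choose [f] with the maximal number [S] of sign changes of [f x - x]; if some
    element fixes two points then [S >= 2]. An element close to the identity
    must be smaller than [f] near both ends, since otherwise it would create
    another sign change of [f]; by Hoelder's argument the commutators of such
    elements are infinitesimal with respect to [f] at both ends.
    If these commutators are trivial, the elements commuting with everything
    close to the identity form a normal subgroup acting freely, which [f] expands
    by conjugation, and then [f] cannot fix two points. Otherwise the conjugates of
    an infinitesimal element by the powers of [f] (if [S] is odd), or of a
    fixed-point-free element dominating [f] (if [S] is even), are bumps that are
    trivial near the ends; products of many disjoint bumps cross each other more
    than [N] times. *)

Require Import Defs.
From mathcomp Require Import all_boot all_order all_algebra.
From mathcomp Require Import all_classical all_reals all_analysis.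
From mathcomp Require Import ring lra zify.

Set Implicit Arguments.
Unset Strict Implicit.
Unset Printing Implicit Defensive.

Import Order.TTheory GRing.Theory Num.Theory.
Import numFieldNormedType.Exports.

Local Open Scope classical_set_scope.
Local Open Scope card_scope.
Local Open Scope ring_scope.

(** * Groups of homeomorphisms of the interval *)

(** The bound [N] is used through two devices. Irreducibility supplies [N + 1] disjoint translates
    of any compact interval of (0, 1), and a non-identity element cannot have a fixed point in each
    of them; hence one of [N + 1] prescribed conjugates moves every point of the interval, and it is
    still close to the identity if the element was close enough. The second device: two elements of
    the group cannot exchange their order more than [N] times. Smoothness enters in the pigeonhole
    argument. The two contractions there are [a \o b] and [b \o a]: being conjugate they have the
    same derivative at 0, so words of equal length shrink a short interval by nearly the same rate
    per letter. Bumps must fade on both sides, so both ends have to be controlled at once. The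
    parity of [S] tells whether [f] or its inverse pushes points inward near 1, and this is what
    splits the final argument in two. *)

Section Definitions.
Variable R : realType.
Implicit Types (f g h e : R -> R) (G : set (R -> R)).

Definition inv f : R -> R := fun y => xget 0 [set x | f x = y].

(** Elements live on the whole line and are the identity off (0, 1), so that they compose as plain
    functions. In [hg_fix] the indices run over 0..N: [N + 1] fixed points force the identity. *)
Record homeo_group (N : nat) G : Prop := {
  hg_id : G id;
  hg_comp : forall f g, G f -> G g -> G (f \o g);
  hg_inv : forall f, G f -> G (inv f);
  hg_K : forall f, G f -> cancel f (inv f);
  hg_VK : forall f, G f -> cancel (inv f) f;
  hg_lt : forall f, G f -> {mono f : x y / x < y};
  hg_out : forall f x, G f -> ~~ (0 < x < 1) -> f x = x;
  hg_irr : forall x, 0 < x < 1 -> exists2 f, G f & f x != x;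
  hg_fix : forall f (x : nat -> R), G f ->
    (forall i, (i <= N)%N -> 0 < x i < 1 /\ f (x i) = x i) ->
    (forall i, (i < N)%N -> x i < x i.+1) -> f = id }.

Definition cj g h : R -> R := g \o h \o inv g.

(* The neighbourhoods of the identity for pointwise convergence, described by
   the order only: this makes their conjugates neighbourhoods again. *)
Definition near_id (s : seq (R * R)) h : Prop :=
  forall p, p \in s -> p.1 < p.2 -> h p.1 < p.2 /\ p.1 < h p.2.

Definition non_discrete G : Prop :=
  forall s, exists h, [/\ G h, h <> id & near_id s h].

(** The order of germs at 0 from the right. Distinct elements of [G] agree at no point close to 0,
    so it is a total order on [G], invariant under multiplication on both sides. *)
Definition lt0 f g : Prop :=
  exists2 d, 0 < d & forall x, 0 < x < d -> f x < g x.

Definition infinitesimal e f : Prop :=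
  forall k, lt0 (iter k e) f /\ lt0 (iter k (inv e)) f.

(** At least [k] sign changes of f x - x, seen at [k + 1] points. The first sign is positive by
    convention; otherwise one passes to the inverse. *)
Definition altp f (k : nat) (x : nat -> R) : Prop :=
  [/\ forall i, (i <= k)%N -> 0 < x i < 1,
      forall i, (i < k)%N -> x i < x i.+1 &
      forall i, (i <= k)%N -> if odd i then f (x i) < x i else x i < f (x i)].

Definition flip f : R -> R := fun x => 1 - f (1 - x).

Definition flipG G : set (R -> R) := [set f | G (flip f)].

End Definitions.

Section Basics.
Variables (R : realType) (N : nat) (G : set (R -> R)).
Hypothesis HG : homeo_group N G.
Implicit Types (f g h e : R -> R) (x y z : R).

Let Gid := hg_id HG.
Let Gc := hg_comp HG.
Let Gi := hg_inv HG.
Let K := hg_K HG.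
Let VK := hg_VK HG.
Let Glt := hg_lt HG.
Let Gout := hg_out HG.

Lemma G_le f : G f -> {mono f : x y / x <= y}.
Proof. by move=> Gf x y; rewrite !leNgt Glt. Qed.

Lemma G_inj f : G f -> injective f.
Proof. by move=> Gf; exact: can_inj (K Gf). Qed.

Lemma G_cj g h : G g -> G h -> G (cj g h).
Proof. by move=> Gg Gh; do 2?apply: Gc => //; apply: Gi. Qed.

Lemma G_iter n f : G f -> G (iter n f).
Proof. by move=> Gf; elim: n => [|n IH]; [exact: Gid|exact: (Gc Gf IH)]. Qed.

Lemma inv_eq f x y : G f -> f y = x -> inv f x = y.
Proof. by move=> Gf <-; rewrite K. Qed.

Lemma invV f : G f -> inv (inv f) = f.
Proof. by move=> Gf; apply: funext => x; apply: inv_eq; [exact: Gi|exact: K]. Qed.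

Lemma inv_comp f g : G f -> G g -> inv (f \o g) = inv g \o inv f.
Proof.
move=> Gf Gg; apply: funext => x; apply: inv_eq; first exact: Gc.
by rewrite /= VK // VK.
Qed.

Lemma inv_id : inv id = id :> (R -> R).
Proof. by apply: funext => x; apply: inv_eq. Qed.

Lemma inv_cj g h : G g -> G h -> inv (cj g h) = cj g (inv h).
Proof.
move=> Gg Gh; apply: funext => x; apply: inv_eq; first exact: G_cj.
by rewrite /cj /= K // VK // VK.
Qed.

Lemma inv_iter n f : G f -> inv (iter n f) = iter n (inv f).
Proof.
move=> Gf; apply: funext => x; apply: inv_eq; first exact: G_iter.
by elim: n x => [|n IH] x //; rewrite iterSr iterS VK // IH.
Qed.

Lemma iterK n f : G f -> cancel (iter n f) (iter n (inv f)).
Proof. by move=> Gf x; rewrite -inv_iter // K //; apply: G_iter. Qed.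

Lemma iterVK n f : G f -> cancel (iter n (inv f)) (iter n f).
Proof. by move=> Gf x; rewrite -inv_iter // VK //; apply: G_iter. Qed.

Lemma G_in f x : G f -> 0 < x < 1 -> 0 < f x < 1.
Proof.
move=> Gf /andP[x0 x1].
have f0 : f 0 = 0 by rewrite Gout // ltxx.
have f1 : f 1 = 1 by rewrite Gout // ltxx andbF.
by apply/andP; split; [rewrite -f0|rewrite -f1]; rewrite Glt.
Qed.

Lemma lt_inv f x y : G f -> (inv f x < y) = (x < f y).
Proof. by move=> Gf; rewrite -(Glt Gf) VK. Qed.

Lemma inv_lt f x y : G f -> (x < inv f y) = (f x < y).
Proof. by move=> Gf; rewrite -(Glt Gf) VK. Qed.

Lemma inv_neq_id f : G f -> f <> id -> inv f <> id.
Proof. by move=> Gf fid E; apply: fid; rewrite -(invV Gf) E inv_id. Qed.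

Lemma cj_neq_id g h : G g -> G h -> h <> id -> cj g h <> id.
Proof.
move=> Gg Gh hid E; apply: hid; apply: funext => x.
have : cj g h (g x) = g x by rewrite E.
by rewrite /cj /= K // => /(G_inj Gg).
Qed.

Lemma cj_iter g h n x : G g -> iter n (cj g h) x = g (iter n h (inv g x)).
Proof.
move=> Gg; elim: n => [|n IH]; first by rewrite /= VK.
by rewrite !iterS IH /cj /= K.
Qed.

Lemma near_sub (s s' : seq (R * R)) h :
  {subset s <= s'} -> near_id s' h -> near_id s h.
Proof. by move=> ss H p /ss; exact: H. Qed.

Lemma near_cat (s s' : seq (R * R)) h :
  near_id (s ++ s') h -> near_id s h /\ near_id s' h.
Proof.
by move=> H; split; apply: near_sub H => p ps; rewrite mem_cat ps ?orbT.
Qed.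

Lemma near1 x y (s : seq (R * R)) h :
  x < y -> (x, y) \in s -> near_id s h -> h x < y /\ x < h y.
Proof. by move=> xy xs H; exact: (H _ xs). Qed.

Lemma near_idid s : near_id s (@id R).
Proof. by move=> p _; rewrite /=. Qed.

Lemma near_inv s h : G h -> near_id s h -> near_id s (inv h).
Proof.
by move=> Gh H p ps pp; have [] := H _ ps pp; rewrite lt_inv // inv_lt.
Qed.

(** Each pair is cut at its midpoint: one factor stays within one half, the other within the other
    half. *)
Lemma near_comp s : exists s', forall h k, G h -> G k ->
  near_id s' h -> near_id s' k -> near_id s (h \o k).
Proof.
exists (flatten [seq [:: (p.1, (p.1 + p.2) / 2); ((p.1 + p.2) / 2, p.2)] | p <- s]).
move=> h k Gh Gk Hh Hk [l u] ps /= lu.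
set s' := flatten _ in Hh Hk.
have m1 : l < (l + u) / 2 by lra.
have m2 : (l + u) / 2 < u by lra.
have [i1 i2] : (l, (l + u) / 2) \in s' /\ ((l + u) / 2, u) \in s'.
  by split; apply/flatten_mapP; exists (l, u); rewrite // !inE eqxx ?orbT.
have [h1 h2] := near1 m1 i1 Hh; have [h3 h4] := near1 m2 i2 Hh.
have [k1 k2] := near1 m1 i1 Hk; have [k3 k4] := near1 m2 i2 Hk.
split; first by apply: lt_trans h3; rewrite Glt.
by apply: lt_trans h2 _; rewrite Glt.
Qed.

Lemma near_cj g s : G g ->
  exists s', forall h, G h -> near_id s' h -> near_id s (cj g h).
Proof.
move=> Gg; exists [seq (inv g p.1, inv g p.2) | p <- s] => h Gh H p ps pp.
have lt : inv g p.1 < inv g p.2 by rewrite Glt //; apply: Gi.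
have ms : (inv g p.1, inv g p.2) \in [seq (inv g p.1, inv g p.2) | p <- s].
  by apply/mapP; exists p.
have := near1 lt ms H.
by rewrite inv_lt // lt_inv.
Qed.

Lemma near_cjs (g : nat -> R -> R) n s : (forall i, G (g i)) ->
  exists s', forall h, G h -> near_id s' h ->
    forall i, (i <= n)%N -> near_id s (cj (g i) h).
Proof.
move=> Gg; elim: n => [|n [s1 H1]].
  have [s' H] := near_cj s (Gg 0%N); exists s' => h Gh Hh i.
  by rewrite leqn0 => /eqP->; apply: H.
have [s2 H2] := near_cj s (Gg n.+1); exists (s1 ++ s2) => h Gh /near_cat[h1 h2] i.
by rewrite leq_eqVlt => /orP[/eqP->|]; [exact: H2|exact: H1].
Qed.

Lemma near_iter s k : exists s', forall h, G h -> near_id s' h -> near_id s (iter k h).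
Proof.
elim: k s => [|k IH] s; first by exists [::] => h _ _; exact: near_idid.
have [s1 H1] := near_comp s; have [s2 H2] := IH s1.
exists (s1 ++ s2) => h Gh /near_cat[h1 h2].
by apply: (H1 h (iter k h)) => //; [exact: G_iter|exact: H2].
Qed.

Lemma orbit_up f x y : G f -> (forall z, x <= z <= y -> z < f z) ->
  exists n, y < iter n f x.
Proof.
move=> Gf H; apply: contrapT => /forallNP Hn.
have le n : iter n f x <= y by rewrite leNgt; apply/negP/Hn.
pose A := [set iter n f x | n in [set: nat]].
have A0 : A x by exists 0%N.
have uA : ubound A y by move=> _ [n _ <-].
have hA : has_sup A by split; [exists x|exists y].
have xs : x <= sup A by apply: ub_le_sup => //; exists y.
have sy : sup A <= y by apply: ge_sup => //; exists x.
have sf : inv f (sup A) < sup A by rewrite lt_inv //; apply: H; rewrite xs sy.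
have [_ [n _ <-]] := sup_adherent (eps := sup A - inv f (sup A)) ltac:(lra) hA.
have -> : sup A - (sup A - inv f (sup A)) = inv f (sup A) by ring.
rewrite lt_inv // => lt.
have : iter n.+1 f x <= sup A by apply: ub_le_sup => //; [exists y|exists n.+1].
by rewrite leNgt iterS lt.
Qed.

Lemma orbit_down f x y : G f -> (forall z, y <= z <= x -> f z < z) ->
  exists n, iter n f x < y.
Proof.
move=> Gf H; have [] := @orbit_up (inv f) y x (Gi Gf).
  by move=> z zz; rewrite inv_lt //; apply: H.
move=> n lt; exists n; rewrite -[iter n f x < y](Glt (G_iter n (Gi Gf))).
by rewrite iterK.
Qed.

(** Otherwise the supremum of the orbit of [x] would be a global fixed point in (0, 1). *)
Lemma irr_up x y : 0 < x < 1 -> 0 < y < 1 -> exists2 g, G g & y < g x.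
Proof.
move=> x01 y01; apply: contrapT => H.
have le g : G g -> g x <= y.
  by move=> Gg; rewrite leNgt; apply/negP => lt; apply: H; exists g.
pose A := [set g x | g in G].
have A0 : A x by exists id.
have uA : ubound A y by move=> _ [g Gg <-]; exact: le.
have hA : has_sup A by split; [exists x|exists y].
have xs : x <= sup A by apply: ub_le_sup => //; exists y.
have sy : sup A <= y by apply: ge_sup => //; exists x.
have [k Gk kc] : exists2 k, G k & sup A < k (sup A).
  have [|k Gk kk] := hg_irr HG (x := sup A).
    by move/andP: x01 => [? ?]; move/andP: y01 => [? ?]; apply/andP; split; lra.
  case/orP: (lt_total kk) => kc; last by exists k.
  by exists (inv k); [exact: Gi|rewrite inv_lt].
have sk : inv k (sup A) < sup A by rewrite lt_inv.
have [_ [g Gg <-]] := sup_adherent (eps := sup A - inv k (sup A)) ltac:(lra) hA.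
have -> : sup A - (sup A - inv k (sup A)) = inv k (sup A) by ring.
rewrite lt_inv // => lt.
have : k (g x) <= sup A.
  by apply: ub_le_sup; [exists y|exists (k \o g); [exact: Gc|]].
by rewrite leNgt lt.
Qed.

Lemma irr_down x y : 0 < x < 1 -> 0 < y < 1 -> exists2 g, G g & g x < y.
Proof.
move=> x01 y01; have [g Gg lt] := irr_up y01 x01.
by exists (inv g); [exact: Gi|rewrite lt_inv].
Qed.

Lemma fix_first f x y : G f -> x < y -> x < f x -> f y <= y ->
  exists p, [/\ x < p, p <= y, f p = p & forall z, x <= z < p -> z < f z].
Proof.
move=> Gf xy xf fy.
pose A := [set z | x <= z /\ f z <= z].
have Ay : A y by split => //; apply: ltW.
have lA : lbound A x by move=> z [].
have hA : has_inf A by split; [exists y|exists x].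
have xi : x <= inf A by apply: lb_le_inf => //; exists y.
have iy : inf A <= y by apply: ge_inf => //; exists x.
have fi : f (inf A) = inf A.
  apply/eqP; rewrite eq_le; apply/andP; split; rewrite leNgt; apply/negP => lt.
    have [z [xz fz]] := inf_adherent (eps := f (inf A) - inf A) ltac:(lra) hA.
    have -> : inf A + (f (inf A) - inf A) = f (inf A) by ring.
    have : f (inf A) <= f z by rewrite G_le //; apply: ge_inf => //; exists x.
    by move=> ? ?; lra.
  have [le|lt'] := leP (f (inf A)) x.
    have : x < inf A.
      rewrite lt_neqAle xi andbT; apply/eqP => E.
      by rewrite -E in lt; lra.
    rewrite -(Glt Gf) => ?; lra.
  have : A (f (inf A)) by split; [exact: ltW|rewrite G_le //; apply: ltW].
  by move=> /(ge_inf (ex_intro _ x lA)); lra.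
exists (inf A); split=> //.
  by rewrite lt_neqAle xi andbT; apply/eqP => E; move: xf; rewrite E fi ltxx.
move=> z /andP[xz zi]; rewrite ltNge; apply/negP => fz.
have : inf A <= z by apply: ge_inf; [exists x|split].
lra.
Qed.

Lemma fix_last f x y : G f -> x < y -> f x <= x -> y < f y ->
  exists p, [/\ x <= p, p < y, f p = p & forall z, p < z <= y -> z < f z].
Proof.
move=> Gf xy fx yf.
pose A := [set z | z <= y /\ f z <= z].
have Ax : A x by split => //; apply: ltW.
have uA : ubound A y by move=> z [].
have hA : has_sup A by split; [exists x|exists y].
have iy : sup A <= y by apply: ge_sup => //; exists x.
have xi : x <= sup A by apply: ub_le_sup => //; exists y.
have fi : f (sup A) = sup A.
  apply/eqP; rewrite eq_le; apply/andP; split; rewrite leNgt; apply/negP => lt.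
    have sf : inv f (sup A) < sup A by rewrite lt_inv.
    have [z [xz fz]] := sup_adherent (eps := sup A - inv f (sup A)) ltac:(lra) hA.
    have -> : sup A - (sup A - inv f (sup A)) = inv f (sup A) by ring.
    rewrite lt_inv // => ?; have : z <= sup A by apply: ub_le_sup => //; exists y.
    by lra.
  have [le|lt'] := leP y (inv f (sup A)).
    have : f y <= sup A by rewrite -[f y <= _](G_le (Gi Gf)) K.
    by lra.
  have : A (inv f (sup A)).
    split; [exact: ltW|rewrite VK //; apply: ltW].
    by rewrite inv_lt.
  move=> /(ub_le_sup (ex_intro _ y uA)).
  by rewrite leNgt inv_lt // lt.
exists (sup A); split=> //.
  by rewrite lt_neqAle iy andbT; apply/eqP => E; move: yf; rewrite -E fi ltxx.
move=> z /andP[iz zy]; rewrite ltNge; apply/negP => fz.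
have : z <= sup A by apply: ub_le_sup; [exists y|split].
lra.
Qed.

End Basics.

(** * Counting fixed points and sign changes *)

Section Counting.
Variables (R : realType) (N : nat) (G : set (R -> R)).
Hypothesis HG : homeo_group N G.
Implicit Types (f g h e : R -> R) (x y z : R).

Let Gid := hg_id HG.
Let Gc := hg_comp HG.
Let Gi := hg_inv HG.
Let K := hg_K HG.
Let VK := hg_VK HG.
Let Glt := hg_lt HG.
Let Gout := hg_out HG.
Let inv_lt := inv_lt HG.
Let lt_inv := lt_inv HG.
Let G_cj := G_cj HG.

Lemma G0 f : G f -> f 0 = 0.
Proof. by move=> Gf; rewrite Gout // ltxx. Qed.

Lemma G1 f : G f -> f 1 = 1.
Proof. by move=> Gf; rewrite Gout // ltxx andbF. Qed.

Lemma G_gt0 f x : G f -> (0 < f x) = (0 < x).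
Proof. by move=> Gf; rewrite -{1}(G0 Gf) Glt. Qed.

Lemma G_lt1 f x : G f -> (f x < 1) = (x < 1).
Proof. by move=> Gf; rewrite -{1}(G1 Gf) Glt. Qed.

Lemma nonfix_between f a b : G f -> f <> id -> 0 <= a -> a < b -> b <= 1 ->
  exists z, [/\ a < z, z < b & f z != z].
Proof.
move=> Gf fid a0 ab b1; apply: contrapT => H; apply: fid.
pose x (i : nat) : R := a + (b - a) * (i.+1%:R / N.+2%:R).
have lt i : (i <= N)%N -> 0 < (i.+1%:R / N.+2%:R : R) < 1.
  by move=> iN; rewrite divr_gt0 //= ltr_pdivrMr // mul1r ltr_nat.
apply: (hg_fix HG (x := x)) => // i iN.
  have /andP[? ?] := lt _ iN.
  have l1 : a < x i by rewrite /x ltrDl mulr_gt0 // subr_gt0.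
  have l2 : x i < b by rewrite /x -ltrBrDl -[ltRHS]mulr1 ltr_pM2l // subr_gt0.
  split; first by apply/andP; split; lra.
  by apply/eqP; apply: contrapT => /negP fx; apply: H; exists (x i).
rewrite /x ltrD2l ltr_pM2l ?subr_gt0 // ltr_pM2r ?ltr_nat //.
Qed.

Lemma germ_nofix f : G f -> f <> id ->
  exists2 d, 0 < d & forall x, 0 < x < d -> f x != x.
Proof.
move=> Gf fid; apply: contrapT => H; apply: fid.
have /choice[u Hu] : forall d : R, exists x, 0 < d -> 0 < x < d /\ f x = x.
  move=> d; have [d0|] := ltP 0 d; last by exists 0.
  apply: contrapT => H'; apply: H; exists d => // x xd; apply/negP => /eqP fx.
  by apply: H'; exists x.
pose y n := iter n u (u 1).
have y0 n : 0 < y n < 1 /\ f (y n) = y n.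
  elim: n => [|n [/andP[l1 l2] _]]; first exact: (Hu 1).
  by have [/andP[? ?] ?] := Hu _ l1; split=> //; apply/andP; split=> //; exact: lt_trans l2.
(* The fixed points [y n] decrease towards 0, so they are read backwards to be increasing. *)
apply: (hg_fix HG (x := fun i => y (N - i)%N)) => // i iN.
have -> : (N - i = (N - i.+1).+1)%N by lia.
have [/andP[l1 _] _] := y0 (N - i.+1)%N.
by have [/andP[]] := Hu _ l1.
Qed.

Lemma germ_sign f : G f -> f <> id -> lt0 id f \/ lt0 f id.
Proof.
move=> Gf fid; have [d d0 H] := germ_nofix Gf fid.
have d2 : 0 < d / 2 < d by apply/andP; split; lra.
case/orP: (lt_total (H _ d2)) => s; [right|left].
  exists (d / 2); first by lra.
  move=> x /andP[x0 xd]; rewrite ltNge le_eqVlt negb_or; apply/andP; split.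
    by rewrite eq_sym; apply: H; apply/andP; split; lra.
  apply/negP => xf; have [p [l1 l2 fp _]] := fix_first HG Gf xd xf (ltW s).
  have : f p != p by apply: H; apply/andP; split; lra.
  by rewrite fp eqxx.
exists (d / 2); first by lra.
move=> x /andP[x0 xd]; rewrite ltNge; apply/negP => fx.
have [p [l1 l2 fp _]] := fix_last HG Gf xd fx s.
have : f p != p by apply: H; apply/andP; split; lra.
by rewrite fp eqxx.
Qed.

Lemma lt0_trans f g h : lt0 f g -> lt0 g h -> lt0 f h.
Proof.
move=> [d d0 H] [d' d'0 H']; exists (Num.min d d'); first by rewrite lt_min d0.
move=> x; rewrite lt_min => /and3P[x0 xd xd'].
by apply: lt_trans (H x _) (H' x _); rewrite x0.
Qed.

Lemma lt0_irr f : ~ lt0 f f.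
Proof. by move=> [d d0 /(_ (d / 2))]; rewrite ltxx => H; have : false by apply: H; apply/andP; split; lra. Qed.

Lemma lt0_l c f g : G c -> lt0 f g -> lt0 (c \o f) (c \o g).
Proof. by move=> Gf [d d0 H]; exists d => // x xd; rewrite /= Glt //; apply: H. Qed.

Lemma lt0_r c f g : G c -> lt0 f g -> lt0 (f \o c) (g \o c).
Proof.
move=> Gcc [d d0 H]; exists (inv c d); first by rewrite inv_lt // G0.
by move=> x /andP[x0 xd]; apply: H; rewrite G_gt0 // x0 -inv_lt.
Qed.

Lemma lt0_total f g : G f -> G g -> f <> g -> lt0 f g \/ lt0 g f.
Proof.
move=> Gf Gg fg; have Gh : G (inv f \o g) by apply: Gc => //; apply: Gi.
have [|[d d0 H]|[d d0 H]] := germ_sign Gh.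
- move=> E; apply: fg; apply: funext => x; have := congr1 (fun k => f (k x)) E.
  by rewrite /= VK.
- by left; exists d => // x xd; have := H x xd; rewrite /= inv_lt.
- by right; exists d => // x xd; have := H x xd; rewrite /= lt_inv.
Qed.

Lemma lt0_inv f : G f -> lt0 id f -> lt0 (inv f) id.
Proof.
move=> Gf /(lt0_l (Gi Gf)) [d d0 H]; exists d => // x /H.
by rewrite /= K.
Qed.

Lemma lt0_invV f : G f -> lt0 f id -> lt0 id (inv f).
Proof.
move=> Gf /(lt0_l (Gi Gf)) [d d0 H]; exists d => // x /H.
by rewrite /= K.
Qed.

Lemma separators a b : 0 < a -> a <= b -> b < 1 ->
  exists g : nat -> R -> R, (forall i, G (g i)) /\
    forall i j, (i < j)%N -> g i b < g j a.
Proof.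
move=> a0 ab b1.
have a01 : 0 < a < 1 by apply/andP; split; lra.
have b01 : 0 < b < 1 by apply/andP; split; lra.
have /choice[F HF] : forall h : R -> R, exists h', G h -> G h' /\ h b < h' a.
  move=> h; have [Gh|] := pselect (G h); last by exists h.
  by have [g Gg lt] := irr_up HG a01 (G_in HG Gh b01); exists g.
pose g n := iter n F id.
have Gg n : G (g n) by elim: n => [|n IH]; [exact: Gid|case: (HF _ IH)].
exists g; split=> // i j.
elim: j => // j IH; rewrite ltnS leq_eqVlt => /orP[/eqP->|/IH lt].
  by case: (HF _ (Gg j)).
apply: lt_trans lt _; apply: le_lt_trans (_ : g j b < _); last by case: (HF _ (Gg j)).
by rewrite (G_le HG).
Qed.

Lemma fix_disjoint f (g : nat -> R -> R) a b : 0 < a -> a <= b -> b < 1 -> G f ->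
  (forall i, G (g i)) -> (forall i j, (i < j)%N -> g i b < g j a) ->
  (forall i, (i <= N)%N -> exists2 p, a <= p <= b & f (g i p) = g i p) -> f = id.
Proof.
move=> a0 ab b1 Gf Gg lt H.
have /choice[p Hp] : forall i, exists p, (i <= N)%N -> a <= p <= b /\ f (g i p) = g i p.
  move=> i; have [iN|] := leqP i N; last by exists 0.
  by have [p ? ?] := H i iN; exists p.
apply: (hg_fix HG (x := fun i => g i (p i))) => // i iN.
  have [/andP[? ?] ?] := Hp i iN; split=> //.
  by apply: (G_in HG); rewrite ?Gg //; apply/andP; split; lra.
have [/andP[? p1] _] := Hp i (ltnW iN); have [/andP[p2 _] _] := Hp i.+1 iN.
apply: le_lt_trans (_ : g i b < _); first by rewrite (G_le HG).
by apply: lt_le_trans (lt _ _ (ltnSn i)) _; rewrite (G_le HG).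
Qed.

Lemma nofix_sign f a b : G f -> a <= b -> (forall z, a <= z <= b -> f z != z) ->
  (forall z, a <= z <= b -> z < f z) \/ (forall z, a <= z <= b -> f z < z).
Proof.
move=> Gf ab H; have aa : a <= a <= b by rewrite lexx.
case/orP: (lt_total (H a aa)) => s; [right|left] => z /andP[az zb].
  rewrite ltNge le_eqVlt negb_or; apply/andP; split.
    by rewrite eq_sym; apply: H; rewrite az.
  apply/negP => xf; have az' : a < z.
    by rewrite lt_neqAle az andbT; apply/eqP => E; rewrite E in s; lra.
  have [p [l1 l2 fp _]] := fix_last HG Gf az' (ltW s) xf.
  have : f p != p by apply: H; apply/andP; split; lra.
  by rewrite fp eqxx.
rewrite ltNge; apply/negP => fx; have az' : a < z.
  by rewrite lt_neqAle az andbT; apply/eqP => E; rewrite E in s; lra.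
have [p [l1 l2 fp _]] := fix_first HG Gf az' s fx.
have : f p != p by apply: H; apply/andP; split; lra.
by rewrite fp eqxx.
Qed.

Hypothesis ND : non_discrete G.

(** A non-identity [h] has no fixed point in one of the [N + 1] translates of [a, b]; conjugating
    that translate back to [a, b], and inverting if the sign is wrong, gives the element. All
    candidate conjugates are made close to the identity beforehand, as the right index is not known
    in advance. *)
Lemma pos_near s a b : 0 < a -> a <= b -> b < 1 ->
  exists h, [/\ G h, near_id s h & forall z, a <= z <= b -> z < h z].
Proof.
move=> a0 ab b1; have [g [Gg lt]] := separators a0 ab b1.
have [s' Hs'] := near_cjs HG N s (fun i => Gi (Gg i)).
have [h [Gh hid nh]] := ND s'.
have [i iN nofix] : exists2 i, (i <= N)%N & forall z, a <= z <= b -> h (g i z) != g i z.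
  apply: contrapT => H; apply: hid; apply: (fix_disjoint a0 ab b1 Gh Gg lt) => i iN.
  apply: contrapT => H'; apply: H; exists i => // z zab.
  by apply/negP => /eqP ?; apply: H'; exists z.
have nc := Hs' _ Gh nh i iN.
have Gk : G (cj (inv (g i)) h) by apply: G_cj => //; apply: Gi.
have kE z : cj (inv (g i)) h z = inv (g i) (h (g i z)) by rewrite /cj (invV HG).
have nf z : a <= z <= b -> cj (inv (g i)) h z != z.
  move=> zab; rewrite kE; apply/eqP => E; have /eqP := nofix _ zab; apply.
  by rewrite -{2}E VK.
have [H|H] := nofix_sign Gk ab nf; first by exists (cj (inv (g i)) h).
exists (inv (cj (inv (g i)) h)); split; first exact: Gi.
  exact: near_inv HG _ _ Gk nc.
by move=> z zab; rewrite inv_lt //; apply: H.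
Qed.

Lemma altp_le f k (x : nat -> R) : G f -> altp f k x -> (k <= N)%N.
Proof.
move=> Gf [x01 xlt xs]; rewrite leqNgt; apply/negP => Nk.
have /choice[p Hp] : forall i, exists p, (i <= N)%N -> x i < p < x i.+1 /\ f p = p.
  move=> i; have [iN|] := leqP i N; last by exists 0.
  have ik : (i < k)%N by lia.
  have lt := xlt _ ik; have := xs _ (ltnW ik); have := xs _ ik; rewrite /=.
  case: (odd i) => /= s1 s0.
    have [p [l1 l2 fp _]] := fix_last HG Gf lt (ltW s0) s1; exists p; split => //.
    rewrite l2 lt_neqAle l1 !andbT; apply/eqP => E.
    by move: s0; rewrite E fp ltxx.
  have [p [l1 l2 fp _]] := fix_first HG Gf lt s0 (ltW s1); exists p; split => //.
  rewrite l1 lt_neqAle l2 !andbT; apply/eqP => E.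
  by move: s1; rewrite -E fp ltxx.
have fid : f = id.
  apply: (hg_fix HG (x := p)) => // i iN.
    have [/andP[? ?] ?] := Hp i iN; split=> //.
    have /andP[? ?] := x01 i ltac:(lia); have /andP[? ?] := x01 i.+1 ltac:(lia).
    by apply/andP; split; lra.
  have [/andP[? ?] _] := Hp i (ltnW iN); have [/andP[? ?] _] := Hp i.+1 iN; lra.
by have := xs 0%N isT; rewrite fid /= ltxx.
Qed.

Lemma altp_max f k (x : nat -> R) : G f -> altp f k x ->
  exists S f' (x' : nat -> R), [/\ G f', altp f' S x', (k <= S)%N &
    forall g j (y : nat -> R), G g -> altp g j y -> (j <= S)%N].
Proof.
move=> Gf Hf.
pose P n := `[< exists f (x : nat -> R), G f /\ altp f n x >].
have exP : exists n, P n by exists k; apply/asboolP; exists f, x.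
have ubP n : P n -> (n <= N)%N by move=> /asboolP[g [y [Gg]]]; exact: altp_le.
case: (ex_maxnP exP ubP) => S /asboolP[f' [x' [Gf' Hf']]] mx.
exists S, f', x'; split=> //; first by apply: mx; apply/asboolP; exists f, x.
by move=> g j y Gg Hg; apply: mx; apply/asboolP; exists g, y.
Qed.

End Counting.

(** * Reflection of the interval, exchanging the ends 0 and 1 *)

Section Flip.
Variables (R : realType) (N : nat) (G : set (R -> R)).
Hypothesis HG : homeo_group N G.
Implicit Types (f g h e : R -> R) (x y z : R).

Lemma flipK f : flip (flip f) = f.
Proof. by apply: funext => x; rewrite /flip !subKr. Qed.

Lemma flip_id : flip id = id :> (R -> R).
Proof. by apply: funext => x; rewrite /flip subKr. Qed.

Lemma flip_comp f g : flip (f \o g) = flip f \o flip g.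
Proof. by apply: funext => x; rewrite /flip /= subKr. Qed.

Lemma flip_iter k f : flip (iter k f) = iter k (flip f).
Proof.
by elim: k => [|k IH]; [rewrite flip_id|rewrite -[RHS]/(flip f \o iter k (flip f)) -IH -flip_comp].
Qed.

Lemma flip_lt f x y : (flip f x < y) = (1 - y < f (1 - x)).
Proof. by rewrite /flip ltrBlDl -ltrBlDr. Qed.

Lemma lt_flip f x y : (x < flip f y) = (f (1 - y) < 1 - x).
Proof. by rewrite /flip ltrBrDl -ltrBrDr. Qed.

Lemma inv_flip f : G f -> inv (flip f) = flip (inv f).
Proof.
move=> Gf; apply: funext => y.
have E : [set x | flip f x = y] = [set flip (inv f) y].
  apply/seteqP; split => x /=; rewrite /flip.
    move=> <-; rewrite subKr (hg_K HG) // subKr //.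
  by move=> ->; rewrite subKr (hg_VK HG) // subKr.
rewrite {1}/inv E.
exact: (xgetPex 0 (ex_intro _ (flip (inv f) y) (erefl : [set flip (inv f) y] _))).
Qed.

Lemma flip_group : homeo_group N (flipG G).
Proof.
have invE f : flipG G f -> inv f = flip (inv (flip f)).
  by move=> Gf; rewrite -inv_flip // flipK.
split.
- by rewrite /flipG /= flip_id; exact: (hg_id HG).
- by move=> f g Gf Gg; rewrite /flipG /= flip_comp; exact: (hg_comp HG).
- by move=> f Gf; rewrite /flipG /= invE // flipK; exact: (hg_inv HG).
- move=> f Gf x; rewrite invE // {1}/flip.
  have -> : 1 - f x = flip f (1 - x) by rewrite /flip subKr.
  by rewrite (hg_K HG) // subKr.
- move=> f Gf x; rewrite invE //.
  have -> : f (flip (inv (flip f)) x) = 1 - flip f (inv (flip f) (1 - x)).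
    by rewrite /flip subKr.
  by rewrite (hg_VK HG) // subKr.
- move=> f Gf x y; have -> : (f x < f y) = (flip f (1 - y) < flip f (1 - x)).
    by rewrite /flip !subKr ltrD2l ltrN2.
  by rewrite (hg_lt HG) // ltrD2l ltrN2.
- move=> f x Gf x01; have := hg_out HG (x := 1 - x) Gf; rewrite /flip subKr => H.
  apply/eqP; rewrite -(inj_eq (subrI 1)); apply/eqP; apply: H.
  by apply: contra x01 => /andP[? ?]; apply/andP; split; lra.
- move=> x /andP[x0 x1]; have [|f Gf fx] := hg_irr HG (x := 1 - x).
    by apply/andP; split; lra.
  exists (flip f); first by rewrite /flipG /= flipK.
  by apply: contra fx; rewrite /flip => /eqP E; rewrite -{2}E subKr.
move=> f x Gf Hx xlt.
have E : flip f = id.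
  apply: (hg_fix HG (x := fun i => 1 - x (N - i)%N)) => // i iN.
    have [/andP[? ?] fx] := Hx (N - i)%N ltac:(lia).
    rewrite /flip subKr fx; split => //; apply/andP; split; lra.
  have := xlt (N - i.+1)%N ltac:(lia).
  have -> : (N - i = (N - i.+1).+1)%N by lia.
  by move=> ?; lra.
by rewrite -(flipK f) E flip_id.
Qed.

Lemma flip_near s : exists s', forall h, near_id s' h -> near_id s (flip h).
Proof.
exists [seq (1 - p.2, 1 - p.1) | p <- s] => h H p ps pp.
have lt : 1 - p.2 < 1 - p.1 by lra.
have ms : (1 - p.2, 1 - p.1) \in [seq (1 - p.2, 1 - p.1) | p <- s].
  by apply/mapP; exists p.
by have [? ?] := near1 lt ms H; rewrite flip_lt lt_flip.
Qed.

Lemma flip_nd : non_discrete G -> non_discrete (flipG G).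
Proof.
move=> ND s; have [s' Hs'] := flip_near s; have [h [Gh hid nh]] := ND s'.
exists (flip h); split; [by rewrite /flipG /= flipK| |exact: Hs'].
by move=> E; apply: hid; rewrite -(flipK h) E flip_id.
Qed.

End Flip.

(** * Conjugates of infinitesimal elements, and bumps *)

Section Eventually.

Definition ev (P : nat -> Prop) := exists n0, forall n, (n0 <= n)%N -> P n.

Lemma ev_and P Q : ev P -> ev Q -> ev (fun n => P n /\ Q n).
Proof.
move=> [n HP] [m HQ]; exists (maxn n m) => k; rewrite geq_max => /andP[? ?].
by split; [exact: HP|exact: HQ].
Qed.

Lemma ev_mono (P Q : nat -> Prop) : (forall n, P n -> Q n) -> ev P -> ev Q.
Proof. by move=> PQ [n HP]; exists n => k /HP; exact: PQ. Qed.

Lemma ev_true (P : nat -> Prop) : (forall n, P n) -> ev P.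
Proof. by move=> H; exists 0%N. Qed.

Lemma ev_all (P : nat -> nat -> Prop) k : (forall i, ev (P i)) ->
  ev (fun n => forall i, (i <= k)%N -> P i n).
Proof.
move=> H; elim: k => [|k IH].
  by apply: ev_mono (H 0%N) => n Hn i; rewrite leqn0 => /eqP->.
apply: ev_mono (ev_and (H k.+1) IH) => n [H1 H2] i.
by rewrite leq_eqVlt => /orP[/eqP->|]; [|exact: H2].
Qed.

Lemma ev_ex P : ev P -> exists n, P n.
Proof. by move=> [n H]; exists n; apply: H. Qed.

Lemma ev_ge k : ev (fun n => (k <= n)%N).
Proof. by exists k. Qed.

Lemma ev_shift (P : nat -> Prop) k : ev P -> ev (fun n => P (n - k)%N).
Proof. by move=> [n H]; exists (n + k)%N => m nm; apply: H; lia. Qed.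

End Eventually.

Section Dynamics.
Variables (R : realType) (N : nat) (G : set (R -> R)).
Hypothesis HG : homeo_group N G.
Implicit Types (f g h e : R -> R) (x y z : R).

Let Gid := hg_id HG.
Let Gc := hg_comp HG.
Let Gi := hg_inv HG.
Let K := hg_K HG.
Let VK := hg_VK HG.
Let Glt := hg_lt HG.
Let inv_lt := inv_lt HG.
Let lt_inv := lt_inv HG.
Let G_cj := G_cj HG.
Let G_iter := G_iter HG.
Let G_le := G_le HG.

(** The order of [f] and [h] is exchanged 2N + 1 times, which is too many sign changes for
    [inv h \o f]. *)
Lemma no_interleave f h (X w : nat -> R) : G f -> G h ->
  (forall i, (i <= N)%N -> [/\ 0 < X i, X i <= w i, w i < X i.+1 & X i.+1 < 1] /\
     (h (X i) < f (X i) /\ f (w i) < h (w i))) -> False.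
Proof.
move=> Gf Gh H; pose p j := if odd j then w j./2 else X j./2.
have Gk : G (inv h \o f) by apply: Gc => //; apply: Gi.
suff : altp (inv h \o f) N.*2.+1 p by move=> /(altp_le HG Gk); lia.
split=> i iN.
- have [|[? ? ? ?] _] := H i./2; first lia.
  by rewrite /p; case: (odd i); apply/andP; split; lra.
- have [|[? l1 ? ?] [s1 s2]] := H i./2; first lia.
  rewrite /p /= uphalf_half; case: (odd i) => /=; rewrite ?add1n ?add0n //.
  rewrite lt_neqAle l1 andbT; apply/eqP => E; move: s1 s2; rewrite E => s1 s2.
  by have := lt_trans s1 s2; rewrite ltxx.
- have [|_ [s1 s2]] := H i./2; first lia.
  by rewrite /p; case: (odd i) => /=; rewrite ?lt_inv ?inv_lt.
Qed.

Lemma inv_small F a x d : G F -> a <= 1 -> F a = a ->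
  (forall z, 0 < z < a -> z < F z) -> 0 < x < a -> 0 < d ->
  ev (fun n => 0 < iter n (inv F) x < d).
Proof.
move=> GF a1 Fa HF /andP[x0 xa] d0.
have GV := Gi GF.
have dec z : 0 < z < a -> 0 < inv F z < z.
  move=> za; have /andP[z0 _] := za.
  by rewrite lt_inv // HF // andbT inv_lt // (G0 HG GF).
have st n : 0 < iter n (inv F) x < a.
  elim: n => [|n IH] /=; first by rewrite x0.
  by have /andP[? ?] := dec _ IH; case/andP: IH => ? ?; apply/andP; split; lra.
have mono n m : (n <= m)%N -> iter m (inv F) x <= iter n (inv F) x.
  elim: m => [|m IH]; first by rewrite leqn0 => /eqP->.
  rewrite leq_eqVlt => /orP[/eqP->//|/IH]; apply: le_trans.
  by have /dec/andP[_ /ltW] := st m.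
have [|n Hn] := @orbit_down _ _ _ HG (inv F) x (Num.min d x) GV.
  move=> z; rewrite ge_min => /andP[/orP dz zx].
  have z0 : 0 < z by case: dz; [apply: lt_le_trans|apply: lt_le_trans].
  by have /andP[] := dec z ltac:(apply/andP; split; lra).
move: Hn; rewrite lt_min => /andP[Hn _].
exists n => m /mono le; have /andP[-> _] := st m; exact: le_lt_trans le Hn.
Qed.

Lemma cj_iterE n F e x : G F -> cj (iter n F) e x = iter n F (e (iter n (inv F) x)).
Proof. by move=> GF; rewrite /cj /= (inv_iter HG). Qed.

Lemma cj_iterS n F e x : G F ->
  cj (iter n.+1 F) e x = iter n F (cj F e (iter n (inv F) x)).
Proof. by move=> GF; rewrite cj_iterE // iterSr iterS. Qed.

Lemma iter_inv_comm n F x : G F -> iter n (inv F) (F x) = F (iter n (inv F) x).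
Proof. by move=> GF; elim: n => //= n ->; rewrite K // VK. Qed.

Lemma infinitesimal_inv e F : G e -> infinitesimal e F -> infinitesimal (inv e) F.
Proof. by move=> Ge H k; rewrite (invV HG) //; have [? ?] := H k. Qed.

Hypothesis ND : non_discrete G.

(* Otherwise the n-th conjugate moves x above y for all large n, hence also
   moves each F^i x above F^i y. Its powers stay below F, so between F^i x and
   F^(i+1) x it must somewhere move points less than a fixed element close to
   the identity, and the two cross more than N times. *)
Lemma conj_to_id_pos F e a x y : G F -> G e -> 0 < a -> a <= 1 -> F a = a ->
  (forall z, 0 < z < a -> z < F z) -> infinitesimal e F -> lt0 id e ->
  0 < x -> x < y -> y < a -> ev (fun n => cj (iter n F) e x < y).
Proof.
move=> GF Ge a0 a1 Fa HF inf epos x0 xy ya.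
pose th n := cj (iter n F) e.
have Gth n : G (th n) by apply: G_cj => //; apply: G_iter.
have small z d : 0 < z < a -> 0 < d -> ev (fun n => 0 < iter n (inv F) z < d).
  exact: inv_small.
have xa : 0 < x < a by rewrite x0 (lt_trans xy).
apply: contrapT => noev.
have inf_often m : exists2 n, (m <= n)%N & y <= th n x.
  apply: contrapT => H; apply: noev; exists m => n mn; rewrite ltNge.
  by apply/negP => yn; apply: H; exists n.
(* The germs of [cj F e] and [e] at 0 are comparable, so [th n x] is eventually monotone in [n];
   being at least [y] infinitely often, it is so from some index on. *)
have big : ev (fun n => y <= th n x).
  have [E|ne] := pselect (cj F e = e).
    have [n mn Hn] := inf_often 0%N; exists 0%N => m _.
    have E' k z : th k z = e z.
      elim: k z => [|k IH] z; first by rewrite /th cj_iterE.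
      by rewrite /th cj_iterS // E -cj_iterE //; exact: IH.
    by rewrite E' -(E' n).
  have GFe := G_cj GF Ge.
  have [[d d0 Hd]|[d d0 Hd]] := lt0_total HG GFe Ge ne.
    have [m Hm] := small x d xa d0.
    have dec n k : (m <= n)%N -> th (n + k)%N x <= th n x.
      move=> mn; elim: k => [|k IH]; first by rewrite addn0.
      apply: le_trans IH; rewrite addnS /th cj_iterS // cj_iterE //.
      by rewrite G_le ?ltW //; [apply/Hd/Hm; lia|exact: G_iter].
    exists m => n mn; have [n' nn Hn'] := inf_often n.
    by apply: le_trans Hn' _; rewrite -(subnKC nn); apply: dec.
  have [m Hm] := small x d xa d0.
  have inc n k : (m <= n)%N -> th n x <= th (n + k)%N x.
    move=> mn; elim: k => [|k IH]; first by rewrite addn0.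
    apply: (le_trans IH); rewrite addnS /th cj_iterS // cj_iterE //.
    by rewrite G_le ?ltW //; [apply/Hd/Hm; lia|exact: G_iter].
  have [n mn Hn] := inf_often m; exists n => n' nn.
  by apply: le_trans Hn _; rewrite -(subnKC nn); apply: inc.
pose X i := iter i F x.
have X0 i : 0 < X i < a.
  have Ea : iter i F a = a by elim: i => //= i ->.
  rewrite /X (G_gt0 HG); last exact: G_iter.
  by rewrite -[X in _ && (_ < X)]Ea (Glt (G_iter i GF)).
have XS i : X i < X i.+1 by rewrite /X iterS HF // X0.
have Xmono i j : (i <= j)%N -> X i <= X j.
  elim: j => [|j IH]; first by rewrite leqn0 => /eqP->.
  by rewrite leq_eqVlt => /orP[/eqP->//|/IH/le_trans]; apply; apply: ltW.
have Xy i : X i < iter i F y by rewrite (Glt (G_iter i GF)).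
have [h [Gh nh hpos]] : exists h, [/\ G h,
    near_id [seq (X i, iter i F y) | i <- iota 0 N.+1] h &
    forall z, x <= z <= X N.+1 -> z < h z].
  apply: (pos_near HG ND) => //; first exact: (Xmono 0%N).
  by have /andP[] := X0 N.+1; lra.
have hX i : (i <= N)%N -> h (X i) < iter i F y.
  move=> iN; apply: (proj1 (near1 (Xy i) _ nh)).
  by apply/mapP; exists i => //; rewrite mem_iota.
(* In [k i] steps [h] passes from [X i] beyond [X i.+1], whereas [k i] steps of [th n] fall short of
   it for large [n]. Hence [h] exceeds [th n] somewhere along the orbit of [X i] under [th n]. *)
have /choice[k Hk] : forall i, exists k, (i <= N)%N -> X i.+1 < iter k h (X i).
  move=> i; have [iN|] := leqP i N; last by exists 0%N.
  have [|k Hk] := @orbit_up _ _ _ HG h (X i) (X i.+1) Gh.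
    move=> z /andP[z1 z2]; apply: hpos; apply/andP; split.
      exact: le_trans (Xmono 0%N i isT) z1.
    by apply: (le_trans z2); apply: Xmono.
  by exists k.
have [d d0 Hd] := epos.
have E1 : ev (fun n => forall i, (i <= N)%N ->
    [/\ iter (k i) (th n) (X i) < X i.+1, X i < th n (X i) &
        (i <= n)%N -> y <= th (n - i)%N x]).
  apply: ev_all => i; have [d1 d10 Hd1] := (inf (k i)).1.
  have E := ev_and (small (X i) d1 (X0 i) d10) (small (X i) d (X0 i) d0).
  apply: ev_mono (ev_and E (ev_shift i big)) => n [[s1 s2] bg]; split=> //.
    rewrite (cj_iter HG) ?(inv_iter HG) //; last exact: G_iter.
    rewrite -[ltRHS](iterVK HG n GF) (Glt (G_iter n GF)) /X.
    by rewrite -/(X i.+1) /X iterS iter_inv_comm //; exact: Hd1.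
  by rewrite /th cj_iterE // -{1}[X i](iterVK HG n GF) (Glt (G_iter n GF)); apply: Hd.
have [n [Hn nN]] := ev_ex (ev_and E1 (ev_ge N)).
have /choice[w Hw] : forall i, exists w, (i <= N)%N ->
    [/\ X i <= w, w < X i.+1 & th n w < h w].
  move=> i; have [iN|] := leqP i N; last by exists 0.
  have [kX Xt _] := Hn i iN.
  have inc j m : (j <= m)%N -> iter j (th n) (X i) <= iter m (th n) (X i).
    elim: m => [|m IH]; first by rewrite leqn0 => /eqP->.
    rewrite leq_eqVlt => /orP[/eqP->//|/IH/le_trans]; apply.
    by rewrite iterSr G_le ?ltW //; exact: G_iter.
  suff [j jk lt] : exists2 j, (j < k i)%N &
      th n (iter j (th n) (X i)) < h (iter j (th n) (X i)).
    exists (iter j (th n) (X i)) => _; split => //; first exact: (inc 0%N).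
    exact: le_lt_trans (inc _ _ (ltnW jk)) kX.
  apply: contrapT => H.
  have le j : (j <= k i)%N -> iter j h (X i) <= iter j (th n) (X i).
    elim: j => // j IH jk; rewrite !iterS.
    apply: (@le_trans _ _ (h (iter j (th n) (X i)))); first by rewrite G_le // IH // ltnW.
    by rewrite leNgt; apply/negP => lt; apply: H; exists j.
  have := lt_trans (lt_le_trans (Hk i iN) (le _ (leqnn _))) kX.
  by rewrite ltxx.
apply: (@no_interleave (th n) h X w) => // i iN.
have [w1 w2 w3] := Hw i iN; have /andP[X1 _] := X0 i; have /andP[_ X2] := X0 i.+1.
split; first by split => //; apply: lt_le_trans X2 a1.
split=> //; apply: (lt_le_trans (hX _ iN)).
have [_ _ bg] := Hn i iN; have {}bg := bg (leq_trans iN nN).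
have -> : th n (X i) = iter i F (th (n - i)%N x).
  have En : n = (i + (n - i))%N by rewrite subnKC // (leq_trans iN).
  rewrite /th !cj_iterE // {1 2}En iterD; congr (iter i F (iter (n - i) F (e _))).
  by rewrite addnC iterD /X (iterK HG).
by rewrite G_le //; exact: G_iter.
Qed.

(** The sign of [e] near 0 settles one of the two inequalities at once; the other is the positive
    case, for [e] or for its inverse. *)
Lemma conj_to_id F e a x y : G F -> G e -> 0 < a -> a <= 1 -> F a = a ->
  (forall z, 0 < z < a -> z < F z) -> infinitesimal e F ->
  0 < x -> x < y -> y < a ->
  ev (fun n => cj (iter n F) e x < y /\ x < cj (iter n F) e y).
Proof.
move=> GF Ge a0 a1 Fa HF inf x0 xy ya.
have Gn n := G_iter n GF.
have [->|ne] := pselect (e = id).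
  by apply: ev_true => n; rewrite !cj_iterE // !(iterVK HG).
have [pe|ne'] := germ_sign HG Ge ne.
  apply: ev_and; first exact: conj_to_id_pos HF inf pe x0 xy ya.
  have [d d0 Hd] := pe.
  have [|n Hn] := @inv_small F a y d GF a1 Fa HF _ d0; first by rewrite ya (lt_trans x0).
  exists n => m /Hn H; apply: (lt_trans xy).
  by rewrite cj_iterE // -{1}[y](iterVK HG m GF) Glt //; apply: Hd.
have pe := lt0_invV HG Ge ne'; apply: ev_and; last first.
  apply: ev_mono (conj_to_id_pos GF (Gi Ge) a0 a1 Fa HF (infinitesimal_inv Ge inf) pe x0 xy ya).
  by move=> n; rewrite -(inv_cj HG) // lt_inv //; apply: G_cj.
have [d d0 Hd] := ne'.
have [|n Hn] := @inv_small F a x d GF a1 Fa HF _ d0; first by rewrite x0 (lt_trans xy).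
exists n => m /Hn H; apply: lt_trans xy.
by rewrite cj_iterE // -{2}[x](iterVK HG m GF) Glt //; apply: Hd.
Qed.

(** * Products of bumps that are asymptotically disjoint *)

Section Bumps.
Variables (th : nat -> R -> R) (ph : nat -> nat -> R -> R) (l r x1 x0 w : R).
Hypotheses (Gth : forall n, G (th n)) (Gph : forall i n, G (ph i n)).
Hypotheses (lx : l < x1) (xx : x1 < x0) (xw : x0 < w) (wr : w < r) (x01 : 0 < x0 < 1).

Implicit Types (b : nat -> bool) (i j J n : nat).

(** Bump [j] seen from position [i]; by [C_small] distinct bumps do not feel each other in the
    limit. Both [th] and [ph] may depend on [n], to cover bumps that sharpen at fixed positions as
    well as a fixed bump carried to positions that drift apart. *)
Let C i j n := cj (inv (ph i n)) (cj (ph j n) (th n)).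

Hypothesis th_big : ev (fun n => w <= th n x1).
Hypothesis ph_lt : forall i j, (i < j)%N -> ev (fun n => ph i n x0 < ph j n x0).
Hypothesis C_small : forall i j, i <> j -> forall x y, l < x -> x < y -> y < r ->
  ev (fun n => C i j n x < y /\ x < C i j n y).

Fixpoint bump_prod (b : nat -> bool) J n : R -> R :=
  if J is J'.+1 then
    if b J' then cj (ph J' n) (th n) \o bump_prod b J' n else bump_prod b J' n
  else id.

Let D b i J n := inv (ph i n) \o bump_prod b J n \o ph i n.

Let G_bump b J n : G (bump_prod b J n).
Proof.
by elim: J => [|J IH] //=; case: (b J) => //; apply: Gc => //; apply: G_cj.
Qed.

Let G_C i j n : G (C i j n).
Proof. by apply: G_cj; [exact: Gi|exact: G_cj]. Qed.

Let DS b i J n x : D b i J.+1 n x = if b J then C i J n (D b i J n x) else D b i J n x.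
Proof. by rewrite /D /C /=; case: (b J) => //=; rewrite /cj (invV HG) //= VK. Qed.

Lemma bump_small b i J : (forall j, (j < J)%N -> b j -> i <> j) ->
  forall x y, l < x -> x < y -> y < r -> ev (fun n => D b i J n x < y /\ x < D b i J n y).
Proof.
elim: J => [|J IH] H x y lx' xy yr.
  by apply: ev_true => n; rewrite /D /= !K.
have IH' := IH (fun j jJ => H j (ltnW jJ)).
case bJ : (b J); last by apply: ev_mono (IH' _ _ lx' xy yr) => n; rewrite !DS bJ.
have iJ := H J (ltnSn J) bJ; pose m := (x + y) / 2.
have [xm my] : x < m /\ m < y by rewrite /m; split; lra.
have mr : m < r by lra.
have lm : l < m by lra.
apply: ev_mono (ev_and (ev_and (IH' _ _ lx' xm mr) (IH' _ _ lm my yr))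
  (ev_and (C_small iJ lx' xm mr) (C_small iJ lm my yr))) => n.
move=> [[[D1 _] [_ D4]] [[_ C2] [C3 _]]]; rewrite !DS bJ; split.
  by apply: lt_trans C3; rewrite Glt.
by apply: (lt_trans C2); rewrite Glt.
Qed.

(** The factors applied before bump [i] leave [x0] above [x1], bump [i] then carries it to [w] or
    beyond, and the later factors take back arbitrarily little. *)
Lemma bump_big b i J : b i -> (i < J)%N ->
  forall y, l < y -> y < w -> ev (fun n => y < D b i J n x0).
Proof.
move=> bi; elim: J => // J IH; rewrite ltnS leq_eqVlt => /orP[/eqP<-|iJ] y ly yw.
  have H j : (j < i)%N -> b j -> i <> j by move=> ji _ E; rewrite E ltnn in ji.
  apply: ev_mono (ev_and (bump_small H lx xx (lt_trans xw wr)) th_big) => n [[_ D1] T].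
  rewrite DS bi /C /cj (invV HG) //= !K //.
  by apply: (lt_trans yw); apply: (le_lt_trans T); rewrite Glt.
pose m := (y + w) / 2; have [ym mw] : y < m /\ m < w by rewrite /m; split; lra.
have lm : l < m := lt_trans ly ym.
have mr : m < r := lt_trans mw wr.
have ne : i <> J by move=> E; rewrite E ltnn in iJ.
apply: ev_mono (ev_and (IH iJ m lm mw) (C_small ne ly ym mr)) => n [D1 [_ C2]].
rewrite DS; case: (b J); last by apply: lt_trans D1.
by apply: (lt_trans C2); rewrite Glt.
Qed.

(* The product of the even bumps and the product of the odd bumps dominate
   each other in turn at the points [ph i n x0]. *)
Lemma bumps_contra : False.
Proof.
pose m := (x0 + w) / 2.
have [xm mw] : x0 < m /\ m < w by move: xw => xw'; rewrite /m; split; lra.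
have lx0 : l < x0 := lt_trans lx xx.
have lm : l < m := lt_trans lx0 xm.
have mr : m < r := lt_trans mw wr.
(* Seen from position [i], the product containing bump [i] moves [x0] beyond [m] and the other one
   leaves it below [m]. The 2N + 2 positions form the [N + 1] pairs that [no_interleave] asks
   for. *)
pose J := N.*2.+2; pose od := fun i => odd i; pose en := fun i => ~~ odd i.
have cmp b b' i : (forall j, b j = ~~ b' j) -> b i ->
    ev (fun n => (i < J)%N -> bump_prod b' J n (ph i n x0) < bump_prod b J n (ph i n x0)).
  move=> bb bi; have [iJ|] := ltnP i J; last by move=> ?; apply: ev_true.
  have H j : (j < J)%N -> b' j -> i <> j.
    by move=> _ bj E; move: bi; rewrite bb E bj.
  apply: ev_mono (ev_and (bump_small H lx0 xm mr) (bump_big bi iJ lm mw)) => n.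
  move=> [[D1 _] D2] _; have := lt_trans D1 D2.
  by rewrite /D /= Glt //; exact: Gi.
have E1 i : ev (fun n => [/\ ph i n x0 < ph i.+1 n x0,
    ~~ odd i -> (i < J)%N -> bump_prod od J n (ph i n x0) < bump_prod en J n (ph i n x0) &
    odd i -> (i < J)%N -> bump_prod en J n (ph i n x0) < bump_prod od J n (ph i n x0)]).
  have c1 := @cmp en od i (fun=> erefl).
  have c2 := @cmp od en i (fun j => esym (negbK _)).
  case oi : (odd i) c1 c2; rewrite /en /od oi /= => c1 c2.
    by apply: ev_mono (ev_and (ph_lt (ltnSn i)) (c2 isT)) => n [? ?].
  by apply: ev_mono (ev_and (ph_lt (ltnSn i)) (c1 isT)) => n [? ?].
have [n Hn] := ev_ex (ev_all J E1).
apply: (@no_interleave (bump_prod en J n) (bump_prod od J n)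
  (fun i => ph i.*2 n x0) (fun i => ph i.*2.+1 n x0)) => // i iN.
have J1 : (i.*2.+1 < J)%N by rewrite /J !ltnS leq_double.
have J0 : (i.*2 < J)%N := ltnW J1.
have [l1 s1 _] := Hn i.*2 (ltnW J0).
have [l2 _ s2] := Hn i.*2.+1 (ltnW J1).
split.
  split=> //; first by have /andP[] := G_in HG (Gph i.*2 n) x01.
    exact: ltW.
  by have /andP[] := G_in HG (Gph i.+1.*2 n) x01.
split; first by apply: s1; rewrite ?odd_double.
by apply: s2; rewrite /= ?odd_double.
Qed.

End Bumps.

End Dynamics.

(** * Commutators of elements close to the identity *)

Section Commutators.
Variables (R : realType) (N : nat) (G : set (R -> R)).
Hypothesis HG : homeo_group N G.
Implicit Types (f g h e z F : R -> R) (x y : R).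

Let Gid := hg_id HG.
Let Gc := hg_comp HG.
Let Gi := hg_inv HG.
Let K := hg_K HG.
Let VK := hg_VK HG.
Let G_iter := G_iter HG.

Definition comm g h : R -> R := (g \o h) \o (inv g \o inv h).

Lemma G_comm g h : G g -> G h -> G (comm g h).
Proof. by move=> Gg Gh; apply: Gc; apply: Gc => //; apply: Gi. Qed.

Lemma inv_comm g h : G g -> G h -> inv (comm g h) = comm h g.
Proof.
move=> Gg Gh; apply: funext => x; apply: (inv_eq HG); first exact: G_comm.
by rewrite /comm /= !K // !VK.
Qed.

Lemma comm_eq_id g h : G g -> G h -> comm g h = id -> g \o h = h \o g.
Proof.
move=> Gg Gh E; apply: funext => x; have := congr1 (fun k => k (h (g x))) E.
by rewrite /comm /= !K.
Qed.

Lemma cj_comm k g h : G k -> G g -> G h -> cj k (comm g h) = comm (cj k g) (cj k h).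
Proof.
move=> Gk Gg Gh; apply: funext => x.
by rewrite /comm !(inv_cj HG) // /cj /= !K.
Qed.

Lemma near_comm s : exists s', forall h1 h2, G h1 -> G h2 ->
  near_id s' h1 -> near_id s' h2 -> near_id s (comm h1 h2).
Proof.
have [s1 H1] := near_comp HG s; have [s2 H2] := near_comp HG s1.
exists s2 => h1 h2 Gh1 Gh2 n1 n2.
apply: (H1 _ _ (Gc Gh1 Gh2) (Gc (Gi Gh1) (Gi Gh2))); first exact: H2.
by apply: H2; try exact: Gi; apply: near_inv HG _ _ _ _.
Qed.

Definition le0 f g := f = g \/ lt0 f g.

Lemma le0_lt0 f g h : le0 f g -> lt0 g h -> lt0 f h.
Proof. by move=> [->//|]; apply: lt0_trans. Qed.

Lemma lt0_le0 f g h : lt0 f g -> le0 g h -> lt0 f h.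
Proof. by move=> fg [<-//|]; apply: lt0_trans. Qed.

Lemma le0_trans f g h : le0 f g -> le0 g h -> le0 f h.
Proof. by move=> [->//|fg] [<-|gh]; right => //; apply: lt0_trans gh. Qed.

Lemma le0_l c f g : G c -> le0 f g -> le0 (c \o f) (c \o g).
Proof. by move=> Gc' [->|fg]; [left|right; apply: (lt0_l HG)]. Qed.

Lemma le0_r c f g : G c -> le0 f g -> le0 (f \o c) (g \o c).
Proof. by move=> Gc' [->|fg]; [left|right; apply: (lt0_r HG)]. Qed.

Lemma not_lt0 f g : G f -> G g -> ~ lt0 f g -> le0 g f.
Proof.
move=> Gf Gg fg; have [->|ne] := pselect (f = g); first by left.
by right; have [|] := lt0_total HG Gf Gg ne.
Qed.

Lemma le0_iter k f g : G f -> G g -> lt0 f g -> le0 (iter k f) (iter k g).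
Proof.
move=> Gf Gg fg; elim: k => [|k IH]; first by left.
apply: (@le0_trans _ (f \o iter k g)); first exact: (le0_l Gf IH).
by right; apply: (lt0_r HG) => //; apply: G_iter.
Qed.

Lemma iter_comp n m f : iter n f \o iter m f = iter (n + m) f.
Proof. by apply: funext => x; rewrite iterD. Qed.

(* Hoelder's argument: h1 and h2 lie between consecutive powers of z. *)
Lemma comm_lt_sq z m (h1 h2 : R -> R) : G z -> G h1 -> G h2 -> lt0 id z ->
  lt0 h1 (iter m z) -> lt0 (inv h1) (iter m z) ->
  lt0 h2 (iter m z) -> lt0 (inv h2) (iter m z) ->
  lt0 (comm h1 h2) (z \o z).
Proof.
move=> Gz G1 G2 zp a1 a2 b1 b2; set Z := iter m z in a1 a2 b1 b2.
have GZ : G Z by apply: G_iter.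
have Gn n : G (iter n z) by apply: G_iter.
have locate u : G u -> lt0 id u -> lt0 u (iter (m + m) z) ->
    exists n, le0 (iter n z) u /\ lt0 u (iter n.+1 z).
  move=> Gu u0 u1.
  have ex : exists n, `[< lt0 u (iter n z) >] by exists (m + m)%N; apply/asboolP.
  case: (ex_minnP ex) => [[|n]] /asboolP un min.
    by case: (lt0_irr (lt0_trans u0 un)).
  exists n; split=> //; apply: not_lt0 => // lt.
  by have := min n (asboolT lt); rewrite ltnn.
(* Multiplying by [Z] makes the elements positive, so that powers of [z] can bracket them. It stands
   left of [h1] and right of [h2] so that Z h1 h2 Z is the product of the two bracketed elements. *)
have [a [a3 a4]] : exists n, le0 (iter n z) (Z \o h1) /\ lt0 (Z \o h1) (iter n.+1 z).
  apply: locate; first exact: Gc.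
    have := lt0_r HG G1 a2; congr lt0; apply: funext => x /=; exact: K.
  by rewrite -iter_comp; apply: (lt0_l HG).
have [b [b3 b4]] : exists n, le0 (iter n z) (h2 \o Z) /\ lt0 (h2 \o Z) (iter n.+1 z).
  apply: locate; first exact: Gc.
    have := lt0_l HG G2 b2; congr lt0; apply: funext => x /=; exact: VK.
  by rewrite -iter_comp; apply: (lt0_r HG).
(* As [Z] commutes with the powers of [z], the lower bounds pass to h1 Z and Z h2, the factors of Z
   h2 h1 Z. The upper and lower exponents then differ by 2, whence the square of [z]. *)
have comZ n : Z \o iter n z = iter n z \o Z by rewrite /Z !iter_comp addnC.
have a5 : le0 (iter a z) (h1 \o Z).
  have := le0_l (Gi GZ) (le0_r GZ a3); rewrite -comZ.
  by congr le0; apply: funext => x /=; rewrite K.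
have b5 : le0 (iter b z) (Z \o h2).
  have := le0_r (Gi GZ) (le0_l GZ b3); rewrite comZ.
  by congr le0; apply: funext => x /=; rewrite VK.
have up : lt0 (Z \o h1 \o h2 \o Z) (iter (a.+1 + b.+1) z).
  rewrite -iter_comp; apply: lt0_trans (lt0_l HG (Gn a.+1) b4).
  exact: (lt0_r HG (Gc G2 GZ) a4).
have dn : le0 (iter (b + a) z) (Z \o h2 \o h1 \o Z).
  rewrite -iter_comp; apply: (le0_trans (le0_l (Gn b) a5)).
  exact: (le0_r (Gc G1 GZ) b5).
have lt : lt0 (Z \o h1 \o h2 \o Z) (Z \o (z \o z) \o h2 \o h1 \o Z).
  apply: (lt0_le0 up); have -> : (a.+1 + b.+1 = 2 + (b + a))%N by lia.
  have := le0_l (Gn 2%N) dn; rewrite iter_comp; congr le0.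
  by apply: funext => x /=; rewrite /Z -!iterS -!iterSr.
have := lt0_l HG (Gi GZ) (lt0_r HG (Gc (Gi GZ) (Gc (Gi G1) (Gi G2))) lt).
rewrite /comm; congr lt0; apply: funext => x /=.
  by rewrite K // VK.
by rewrite K // VK // !VK.
Qed.

Definition dominates F :=
  [/\ G F, lt0 id F & exists s, forall h, G h -> near_id s h -> lt0 h F].

Lemma infinitesimal_id F : lt0 id F -> infinitesimal id F.
Proof.
move=> F0 k; have E : iter k id = id :> (R -> R).
  by apply: funext => x; elim: k => //= k ->.
by rewrite (inv_id HG) E.
Qed.

(** If all small elements are infinitesimal, so are small commutators. If not, there are arbitrarily
    small [z] with a power at least [F]; choose one with z^(2k) still in the neighbourhood dominated
    by [F]. Hoelder's argument bounds the commutator by z^2, so its k-th power lies below z^(2k),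
    hence below [F]. *)
Lemma comm_infinitesimal F : dominates F -> exists s, forall h1 h2,
  G h1 -> G h2 -> near_id s h1 -> near_id s h2 -> infinitesimal (comm h1 h2) F.
Proof.
move=> [GF F0 [s Hs]].
have [[s1 H1]|H] := pselect (exists s1, forall z, G z -> near_id s1 z -> infinitesimal z F).
  have [s2 H2] := near_comm s1; exists s2 => h1 h2 G1 G2 n1 n2.
  by apply: H1; [exact: G_comm|exact: H2].
exists s => h1 h2 G1 G2 n1 n2 k; rewrite inv_comm //.
suff main u v : G u -> G v -> near_id s u -> near_id s v -> lt0 (iter k (comm u v)) F.
  by split; apply: main.
move=> Gu Gv nu nv; have [sk Hk] := near_iter HG s (k + k).
have [z [Gz nz z0 [m Hm]]] : exists z, [/\ G z, near_id sk z, lt0 id z &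
    exists m, ~ lt0 (iter m z) F].
  have [z [Gz nz zi]] : exists z, [/\ G z, near_id sk z & ~ infinitesimal z F].
    apply: contrapT => H'; apply: H; exists sk => z Gz nz.
    by apply: contrapT => zi; apply: H'; exists z.
  have zne : z <> id by move=> E; apply: zi; rewrite E; apply: infinitesimal_id.
  have fin (y : R -> R) : G y -> lt0 id y -> ~ infinitesimal y F -> exists m, ~ lt0 (iter m y) F.
    move=> Gy y0 yi; apply: contrapT => Hn; apply: yi => m; split.
      by apply: contrapT => Hm; apply: Hn; exists m.
    apply: le0_lt0 F0; have := le0_iter m (Gi Gy) Gid (lt0_inv HG Gy y0).
    by congr le0; apply: funext => x; elim: m => //= m ->.
  have [z0|z0] := germ_sign HG Gz zne; first by exists z; split => //; apply: fin.
  exists (inv z); split; [exact: Gi|exact: near_inv HG _ _ Gz nz|exact: lt0_invV HG _ _ _|].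
  apply: fin; [exact: Gi|exact: lt0_invV HG _ _ _|] => zi'; apply: zi.
  by rewrite -(invV HG Gz); apply: (infinitesimal_inv HG) => //; apply: Gi.
have Fz := not_lt0 (G_iter m Gz) GF Hm.
have bd h : G h -> near_id s h -> lt0 h (iter m z).
  by move=> Gh nh; apply: lt0_le0 (Hs _ Gh nh) Fz.
have niv h : G h -> near_id s h -> near_id s (inv h) by move=> ? ?; apply: near_inv HG _ _ _ _.
have lt : lt0 (comm u v) (z \o z).
  by apply: (comm_lt_sq (m := m)) => //; apply: bd => //; try exact: Gi; apply: niv.
apply: le0_lt0 (le0_iter k (G_comm Gu Gv) (Gc Gz Gz) lt) _.
have -> : iter k (z \o z) = iter (k + k) z.
  by apply: funext => x; elim: k {Hk} => //= k ->; rewrite addnS.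
by apply: Hs; [exact: G_iter|exact: Hk].
Qed.

End Commutators.

(** * The case where a neighbourhood of the identity commutes *)

Section CommutingNeighbourhood.
Variables (R : realType) (N : nat) (G : set (R -> R)).
Hypothesis HG : homeo_group N G.
Hypothesis ND : non_discrete G.
Implicit Types (f g h k e : R -> R) (x y z p q : R).

Let Gid := hg_id HG.
Let Gc := hg_comp HG.
Let Gi := hg_inv HG.
Let K := hg_K HG.
Let VK := hg_VK HG.
Let Glt := hg_lt HG.
Let inv_lt := inv_lt HG.
Let G_cj := G_cj HG.
Let G_iter := G_iter HG.
Let G_le := G_le HG.

(** Otherwise the orbit of [p] under [k] would be an infinite set of fixed points of [h]. *)
Lemma comm_fix h k p : G h -> G k -> h <> id -> h \o k = k \o h -> 0 < p < 1 ->
  h p = p -> k p = p.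
Proof.
move=> Gh Gk hid.
have main l : G l -> h \o l = l \o h -> 0 < p < 1 -> h p = p -> p < l p -> False.
  move=> Gl E p01 hp lp; apply: hid.
  apply: (hg_fix HG (x := fun i => iter i l p)) => // i _.
    split; first by apply: (G_in HG) => //; apply: G_iter.
    elim: i => //= i IH; have := congr1 (fun u => u (iter i l p)) E.
    by rewrite /= IH.
  by rewrite iterSr (Glt (G_iter i Gl)).
move=> E p01 hp; apply/eqP; apply: contrapT => /negP; case/lt_total/orP => kp.
  apply: (main (inv k)) => //; [exact: Gi| |by rewrite inv_lt].
  apply: funext => x /=; apply: (G_inj HG Gk).
  have := congr1 (fun u => u (inv k x)) E.
  by rewrite /= !VK // => ->.
exact: (main k).
Qed.

Variable s : seq (R * R).
Hypothesis commute : forall h1 h2, G h1 -> G h2 -> near_id s h1 -> near_id s h2 ->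
  h1 \o h2 = h2 \o h1.

(** If h is not the identity, every sufficiently small [k] has [N + 1] conjugates commuting with
    [h], which therefore fix [p]. So [k] fixes [N + 1] points and is trivial, against
    non-discreteness. *)
Lemma near_free h p : G h -> near_id s h -> 0 < p < 1 -> h p = p -> h = id.
Proof.
move=> Gh nh p01 hp; apply: contrapT => hid; have /andP[p0 p1] := p01.
have [g [Gg lt]] := separators HG p0 (lexx p) p1.
have [s' Hs'] := near_cjs HG N s (fun i => Gi (Gg i)).
have [k [Gk kid nk]] := ND s'; apply: kid.
apply: (fix_disjoint HG p0 (lexx p) p1 Gk Gg lt) => i iN.
exists p; first by rewrite lexx.
have Gck : G (cj (inv (g i)) k) by apply: G_cj => //; apply: Gi.
have := comm_fix Gh Gck hid (commute Gh Gck nh (Hs' _ Gk nk i iN)) p01 hp.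
by rewrite /cj (invV HG) //= => /(congr1 (g i)); rewrite VK.
Qed.

(** The neighbourhood may depend on [k]; since conjugates of neighbourhoods are neighbourhoods, this
    makes the subgroup normal. *)
Definition almost_central k :=
  G k /\ exists s', forall h, G h -> near_id s' h -> k \o h = h \o k.

Let A := almost_central.

Lemma ac_near h : G h -> near_id s h -> A h.
Proof. by move=> Gh nh; split=> //; exists s => k Gk nk; apply: commute. Qed.

Lemma ac_free k p : A k -> 0 < p < 1 -> k p = p -> k = id.
Proof.
move=> [Gk [s' Hs']] p01 kp; apply: contrapT => kid.
have [h [Gh hid /near_cat[n1 n2]]] := ND (s ++ s'); apply: hid.
by apply: (near_free Gh n1 p01); apply: (comm_fix Gk Gh kid (Hs' _ Gh n2)).
Qed.

Lemma ac_comp k l : A k -> A l -> A (k \o l).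
Proof.
move=> [Gk [s1 H1]] [Gl [s2 H2]]; split; first exact: Gc.
exists (s1 ++ s2) => h Gh /near_cat[n1 n2].
have E1 := H1 _ Gh n1; have E2 := H2 _ Gh n2.
apply: funext => x; have := congr1 (fun u => u x) E2; rewrite /= => ->.
exact: (congr1 (fun u => u (l x)) E1).
Qed.

Lemma ac_inv k : A k -> A (inv k).
Proof.
move=> [Gk [s1 H1]]; split; [exact: Gi|exists s1] => h Gh nh.
apply: funext => x /=; apply: (G_inj HG Gk).
by have := congr1 (fun u => u (inv k x)) (H1 _ Gh nh); rewrite /= !VK.
Qed.

Lemma ac_cj g k : G g -> A k -> A (cj g k).
Proof.
move=> Gg [Gk [s1 H1]]; split; first exact: G_cj.
have [s2 H2] := near_cj HG s1 (Gi Gg); exists s2 => h Gh nh.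
apply: funext => x; have := congr1 (fun u => g (u (inv g x))) (H1 _ (G_cj (Gi Gg) Gh) (H2 _ Gh nh)).
by rewrite /cj (invV HG) //= !VK.
Qed.

(** By freeness [inv k \o l] has no interior fixed point, so its displacement keeps one sign. *)
Lemma ac_lt k l p x : A k -> A l -> 0 < p < 1 -> 0 < x < 1 -> k p < l p -> k x < l x.
Proof.
move=> Ak Al p01 x01 lt; have [Gk Gl] := (Ak.1, Al.1).
have Ac : A (inv k \o l) by apply: ac_comp => //; apply: ac_inv.
have pos : p < (inv k \o l) p by rewrite /= inv_lt.
have nofix z : 0 < z < 1 -> (inv k \o l) z != z.
  move=> z01; apply/eqP => E; have := ac_free Ac z01 E.
  by move=> E'; move: pos; rewrite E' ltxx.
rewrite -inv_lt //.
move: p01 x01 => /andP[p0 p1] /andP[x0 x1].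
have [a [b [a0 b1 ap ax]]] : exists a b, [/\ 0 < a, b < 1, a <= p <= b & a <= x <= b].
  have [le|lt'] := leP p x; first by exists p, x; rewrite !lexx le.
  by exists x, p; rewrite !lexx (ltW lt').
have [||H|H] := @nofix_sign _ _ _ HG (inv k \o l) a b (Ac.1).
- by case/andP: ap => ? ?; lra.
- by move=> z /andP[? ?]; apply: nofix; apply/andP; split; lra.
- exact: H.
by have := H p ap; move: pos => /= ? ?; lra.
Qed.

(* The conjugates of h by the powers of f grow beyond every power of a small
   element k, although they all move p to a point below q. *)
Lemma ac_expansion f h p q : G f -> f p = p -> f q = q -> 0 < p -> q < 1 -> A h ->
  p < h p -> h p < q -> h p < cj f h p -> False.
Proof.
move=> Gf fp fq p0 q1 Ah hp hq he; have Gh := Ah.1.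
have p01 : 0 < p < 1 by apply/andP; split; lra.
have hp01 : 0 < h p < 1 by apply: (G_in HG).
pose e := cj f h; have Ae : A e by apply: ac_cj.
pose c := e \o inv h; have Ac : A c by apply: ac_comp => //; apply: ac_inv.
have idA : A id by apply: ac_near => //; apply: near_idid.
have cpos z : 0 < z < 1 -> z < c z.
  by move=> z01; apply: (ac_lt idA Ac hp01 z01); rewrite /c /= K.
have [m Hm] : exists m, h p < iter m c p.
  apply: (orbit_up HG) => [|z /andP[? ?]]; first exact: Ac.1.
  by apply: cpos; apply/andP; split; lra.
(* The m-th power of [c] carries [p] past [h p]; [k] is chosen so small that its m-th power does
   not. *)
have [s2 H2] := near_iter HG [:: (p, h p)] m.
have [k [Gk /near_cat[nk nk2] kpos]] :=
  pos_near HG ND (s ++ s2) p0 (lexx p) ltac:(lra).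
have Ak : A k by apply: ac_near.
have kp : p < k p by apply: kpos; rewrite lexx.
have km : iter m k p < h p.
  by have [] := near1 hp (mem_head _ _) (H2 _ Gk nk2).
have kgt z : 0 < z < 1 -> z < k z by move=> z01; apply: (ac_lt idA Ak p01 z01).
pose cn n := cj (iter n f) c.
have Acn n : A (cn n) by apply: ac_cj => //; apply: G_iter.
have Gcn n : G (cn n) := (Acn n).1.
have fnp n : iter n f p = p by elim: n => //= n ->.
have ifnp n : iter n (inv f) p = p.
  by rewrite -{1}(fnp n) (iterK HG).
pose y n := iter n f (h p).
have eE : e p = f (h p) by rewrite /e /cj /= -{1}fp K.
have yge n : h p <= y n.
  elim: n => [|n IH]; first by rewrite /y.
  apply: (le_trans IH); rewrite /y iterSr G_le; last exact: G_iter.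
  by rewrite -eE ltW.
(* The m-th power of [cn n] sends [p] beyond f^n (h p) >= h p, out of reach for the m-th power of
   [k]; so [cn n] is above [k] at [p], hence everywhere. *)
have kcn n : k p < cn n p.
  rewrite ltNge; apply/negP => le.
  have le' z : 0 < z < 1 -> cn n z <= k z.
    move=> z01; move: le; rewrite le_eqVlt => /orP[/eqP E|lt]; last first.
      exact/ltW/(ac_lt (Acn n) Ak p01 z01 lt).
    have := ac_free (ac_comp (ac_inv (Acn n)) Ak) p01; rewrite /= -E K // => /(_ erefl).
    by move=> /(congr1 (fun u => cn n (u z))); rewrite /= VK // => ->.
  have itle j : iter j (cn n) p <= iter j k p.
    elim: j => //= j IH; apply: le_trans (le' _ _); first by rewrite G_le.
    by apply: (G_in HG) => //; apply: G_iter.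
  have := itle m; rewrite {1}/cn (cj_iter HG) ?(inv_iter HG) //; last exact: G_iter.
  rewrite ifnp => le2.
  have : y n < iter n f (iter m c p) by rewrite (Glt (G_iter n Gf)).
  by have := yge n; lra.
(* Each step from [y n] to [y n.+1] thus moves further than [k] does, so [y n] would pass [q], which
   [f] fixes. *)
have yS n : y n.+1 = cn n (y n).
  rewrite /y /cn (cj_iterE HG) // (iterK HG) // iterSr -eE.
  by congr (iter n f _); rewrite /c /= K.
have y01 n : 0 < y n < 1 by apply: (G_in HG) => //; apply: G_iter.
have yk n : iter n k p <= y n.
  elim: n => [|n IH]; first exact/ltW.
  rewrite yS; apply: ltW; apply: le_lt_trans (ac_lt Ak (Acn n) p01 (y01 n) (kcn n)).
  by rewrite iterS G_le.
have [n Hn] : exists n, q < iter n k p.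
  apply: (orbit_up HG) => // z /andP[? ?]; apply: kgt; apply/andP; split; lra.
have yq : y n < q.
  have <- : iter n f q = q by elim: n {Hn} => //= n ->.
  by rewrite (Glt (G_iter n Gf)).
by have := yk n; lra.
Qed.

(** Take a small [h] moving [p] up to a point below [q]. If conjugation by [f] changes [h p], then
    [f] or its inverse expands [h]. If not, freeness makes [h] commute with [f], and then [h] has to
    fix [p]. *)
Lemma commuting_two_fix f p q : G f -> 0 < p -> p < q -> q < 1 -> f p = p -> f q = q ->
  f = id.
Proof.
move=> Gf p0 pq q1 fp fq; apply: contrapT => fid.
have p01 : 0 < p < 1 by apply/andP; split; lra.
have [h [Gh /near_cat[nh nh2] hpos]] :=
  pos_near HG ND (s ++ [:: (p, q)]) p0 (lexx p) ltac:(lra).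
have Ah : A h by apply: ac_near.
have hp : p < h p by apply: hpos; rewrite lexx.
have [hq _] := near1 pq (mem_head _ _) nh2; rewrite /= in hq.
have Ae : A (cj f h) by apply: ac_cj.
have [lt|lt|E] := ltgtP (h p) (cj f h p).
- exact: (ac_expansion Gf fp fq p0 q1 Ah hp hq lt).
- apply: (ac_expansion (Gi Gf) _ _ p0 q1 Ah hp hq).
  + by rewrite -{1}fp K.
  + by rewrite -{1}fq K.
  rewrite /cj (invV HG) //= fp inv_lt //.
  by move: lt; rewrite /cj /= -{1}fp K.
have E' := ac_free (ac_comp (ac_inv Ah) Ae) p01; rewrite /= -E K // in E'.
have {}E' := E' erefl.
suff : h p = p by move=> E2; rewrite E2 ltxx in hp.
apply: (comm_fix Gf Gh fid) => //.
apply: funext => x; have := congr1 (fun u => h (u (f x))) E'.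
by rewrite /= VK // /cj /= K.
Qed.

End CommutingNeighbourhood.

(** * Elements with the maximal number of sign changes *)

Section Infinitesimals.
Variables (R : realType) (N : nat) (G : set (R -> R)).
Hypothesis HG : homeo_group N G.
Hypothesis ND : non_discrete G.
Implicit Types (f g h e F : R -> R) (x y z p q : R).

Let Gid := hg_id HG.
Let Gc := hg_comp HG.
Let Gi := hg_inv HG.
Let VK := hg_VK HG.
Let inv_lt := inv_lt HG.
Let lt_inv := lt_inv HG.
Let G_cj := G_cj HG.
Let HF := flip_group HG.

Lemma flip_in f : G f -> flipG G (flip f).
Proof. by rewrite /flipG /= flipK. Qed.

(* A nearby element not dominated by f would create, near 0, one more sign
   change than f has. *)
Lemma max_dominates f S (x : nat -> R) : G f -> altp f S x ->
  (forall g j (y : nat -> R), G g -> altp g j y -> (j <= S)%N) -> dominates G f.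
Proof.
move=> Gf [x01 xlt xs] mx.
(* With these pairs [inv h \o f] keeps the sign of [f] at every [x i]. *)
pose s := flatten [seq [:: (x i, f (x i)); (f (x i), x i)] | i <- iota 0 S.+1].
have in_s i : (i <= S)%N -> (x i, f (x i)) \in s /\ (f (x i), x i) \in s.
  by move=> iS; split; apply/flatten_mapP; exists i;
    rewrite ?mem_iota ?add0n ?ltnS ?inE ?eqxx ?orbT.
have dom h : G h -> near_id s h -> lt0 h f.
  move=> Gh nh; have Gk : G (inv h \o f) by apply: Gc => //; apply: Gi.
  have sg i : (i <= S)%N ->
      if odd i then (inv h \o f) (x i) < x i else x i < (inv h \o f) (x i).
    move=> iS; have [s1 s2] := in_s _ iS; have := xs _ iS; rewrite /=.
    case: (odd i) => lt; first by rewrite lt_inv //; have [] := near1 lt s2 nh.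
    by rewrite inv_lt //; have [] := near1 lt s1 nh.
  have kid : inv h \o f <> id by move=> E; have := sg 0%N isT; rewrite E /= ltxx.
  have [[d d0 Hd]|[d d0 Hd]] := germ_sign HG Gk kid.
    by exists d => // z /Hd; rewrite /= inv_lt.
  have /andP[x0 x1] := x01 0%N isT.
  pose y : R := Num.min d (x 0%N) / 2.
  have m0 : 0 < Num.min d (x 0%N) by rewrite lt_min d0.
  have md : Num.min d (x 0%N) <= d by rewrite ge_min lexx.
  have mx0 : Num.min d (x 0%N) <= x 0%N by rewrite ge_min lexx orbT.
  have y0 : 0 < y by rewrite /y; lra.
  have yd : y < d by rewrite /y; lra.
  have yx : y < x 0%N by rewrite /y; lra.
  (* Near 0, [inv h \o f] moves points down, so the signs now begin with a negative one at [y]; the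
     inverse restores the convention. *)
  have : altp (inv (inv h \o f)) S.+1 (fun i => if i is j.+1 then x j else y).
    split=> [[|i] iS|[|i] iS|[|i] iS] //.
    - by rewrite y0 /=; lra.
    - exact: x01.
    - exact: xlt.
    - by rewrite inv_lt //; apply: Hd; rewrite y0.
    by have := sg i iS; rewrite /=; case: (odd i) => /= ?; rewrite ?(lt_inv _ _ Gk) ?(inv_lt _ _ Gk).
  by move=> /(mx _ _ _ (Gi Gk)); rewrite ltnn.
split=> //; last by exists s.
by apply: dom => //; apply: near_idid.
Qed.

Lemma flip_comm g h : G g -> G h -> flip (comm g h) = comm (flip g) (flip h).
Proof. move=> Gg Gh; rewrite /comm (flip_comp (g \o h)) (flip_comp g) (flip_comp (inv g)).
by rewrite !(inv_flip HG). Qed.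

(** A nontrivial small commutator moves [r] after conjugation by one of the separators, and the
    conjugate is again a commutator of small elements, hence infinitesimal at both ends. The ends
    have separate elements [F] and [F1] because the inverse may be the dominating one at 1. *)
Lemma exists_infinitesimal F F1 : dominates G F -> dominates (flipG G) (flip F1) ->
  (forall s, exists h1 h2, [/\ G h1, G h2, near_id s h1, near_id s h2 & h1 \o h2 <> h2 \o h1]) ->
  forall s r, 0 < r < 1 -> exists e, [/\ G e, near_id s e, infinitesimal e F,
    infinitesimal (flip e) (flip F1) & r < e r].
Proof.
move=> D0 D1 NC s r /andP[r0 r1].
have [s0 H0] := comm_infinitesimal HG D0.
have [s1' H1'] := comm_infinitesimal HF D1; have [s1 H1] := flip_near s1'.
have [s2 H2] := near_comm HG s.
have [g [Gg lt]] := separators HG r0 (lexx r) r1.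
have [s3 H3] := near_cjs HG N (s0 ++ s1 ++ s2) (fun i => Gi (Gg i)).
have [h1 [h2 [G1 G2 n1 n2 nc]]] := NC s3.
have Ge := G_comm HG G1 G2.
have [i iN mv] : exists2 i, (i <= N)%N & comm h1 h2 (g i r) <> g i r.
  apply: contrapT => H; apply: nc; apply: (comm_eq_id HG) => //.
  apply: (fix_disjoint HG r0 (lexx r) r1 Ge Gg lt) => i iN.
  exists r; first by rewrite lexx.
  by apply: contrapT => E; apply: H; exists i.
pose k1 := cj (inv (g i)) h1; pose k2 := cj (inv (g i)) h2.
have Gk1 : G k1 by apply: G_cj => //; apply: Gi.
have Gk2 : G k2 by apply: G_cj => //; apply: Gi.
have /near_cat[a0 /near_cat[a1 a2]] := H3 _ G1 n1 i iN.
have /near_cat[b0 /near_cat[b1 b2]] := H3 _ G2 n2 i iN.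
have Gk := G_comm HG Gk1 Gk2.
have kr : comm k1 k2 r != r.
  apply/eqP; rewrite -(cj_comm HG) //; last exact: Gi.
  by rewrite /cj (invV HG) //= => /(congr1 (g i)); rewrite VK.
have i0 := H0 _ _ Gk1 Gk2 a0 b0.
have i1 : infinitesimal (flip (comm k1 k2)) (flip F1).
  by rewrite flip_comm //; apply: H1'; [exact: flip_in|exact: flip_in|exact: H1|exact: H1].
have nk := H2 _ _ Gk1 Gk2 a2 b2.
case/orP: (lt_total kr) => lr; last by exists (comm k1 k2).
exists (inv (comm k1 k2)); split; [exact: Gi|exact: near_inv HG _ _ _ nk| | |by rewrite inv_lt].
  exact: infinitesimal_inv HG _ _ _ i0.
by rewrite -(inv_flip HG) //; apply: (infinitesimal_inv HF) => //; apply: flip_in.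
Qed.

Lemma first_fixpoint f x : G f -> lt0 id f -> 0 < x < 1 -> f x <= x ->
  exists p, [/\ 0 < p, p <= x, f p = p & forall z, 0 < z < p -> z < f z].
Proof.
move=> Gf [d d0 Hd] /andP[x0 x1] fx.
have dx : d <= x by rewrite leNgt; apply/negP => xd; have := Hd x; rewrite x0 xd => /(_ isT); lra.
have [|||p [p1 p2 p3 p4]] := @fix_first _ _ _ HG f (d / 2) x Gf.
- lra.
- by apply: Hd; apply/andP; split; lra.
- exact: fx.
exists p; split=> //; first lra.
move=> z /andP[z0 zp]; have [zd|dz] := ltP z d; first by apply: Hd; rewrite z0.
by apply: p4; apply/andP; split; lra.
Qed.

End Infinitesimals.

(** * The mirror images of the results near 0 *)

Section LastFixpoint.
Variables (R : realType) (N : nat) (G : set (R -> R)).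
Hypothesis HG : homeo_group N G.
Implicit Types (f g h e F : R -> R) (x y z p q : R).
Let HF := flip_group HG.

Lemma last_fixpoint f x : G f -> lt0 id (flip f) -> 0 < x < 1 -> x <= f x ->
  exists p, [/\ p < 1, x <= p, f p = p & forall z, p < z < 1 -> f z < z].
Proof.
move=> Gf f1 /andP[x0 x1] fx.
have [||p [p0 px fp Hp]] := @first_fixpoint _ _ _ HF (flip f) (1 - x) (flip_in Gf) f1.
- by apply/andP; split; lra.
- by rewrite /flip subKr; lra.
exists (1 - p); split; [lra|lra|by move: fp; rewrite /flip; lra|].
move=> z /andP[z1 z2]; have := Hp (1 - z); rewrite /flip subKr => H.
have : 1 - z < 1 - f z by apply: H; apply/andP; split; lra.
by move=> ?; lra.
Qed.

Lemma conj_to_id_last F e b x y : non_discrete G -> G F -> G e ->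
  0 <= b -> b < 1 -> F b = b -> (forall z, b < z < 1 -> F z < z) ->
  infinitesimal (flip e) (flip F) -> b < x -> x < y -> y < 1 ->
  ev (fun n => cj (iter n F) e x < y /\ x < cj (iter n F) e y).
Proof.
move=> ND GF Ge b0 b1 Fb HFb inf bx xy y1.
have fb : flip F (1 - b) = 1 - b by rewrite /flip subKr Fb.
have Hz z : 0 < z < 1 - b -> z < flip F z.
  move=> /andP[z0 zb]; rewrite lt_flip; apply: HFb; apply/andP; split; lra.
have := @conj_to_id _ _ _ HF (flip_nd ND) (flip F) (flip e) (1 - b) (1 - y) (1 - x)
  (flip_in GF) (flip_in Ge) ltac:(lra) ltac:(lra) fb Hz inf ltac:(lra) ltac:(lra) ltac:(lra).
apply: ev_mono => n.
have -> : cj (iter n (flip F)) (flip e) = flip (cj (iter n F) e).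
  rewrite /cj (flip_comp (iter n F \o e)) (flip_comp (iter n F)) -flip_iter.
  by rewrite (inv_flip HG) //; apply: (G_iter HG).
by rewrite /flip !subKr => -[? ?]; split; lra.
Qed.

End LastFixpoint.

(** * Bumps built from a dominating element *)

Section Contradictions.
Variables (R : realType) (N : nat) (G : set (R -> R)).
Hypothesis HG : homeo_group N G.
Hypothesis ND : non_discrete G.
Hypothesis NC : forall s, exists h1 h2 : R -> R,
  [/\ G h1, G h2, near_id s h1, near_id s h2 & h1 \o h2 <> h2 \o h1].
Implicit Types (f g h e F t : R -> R) (x y z p q : R).

Let Gid := hg_id HG.
Let Gc := hg_comp HG.
Let Gi := hg_inv HG.
Let K := hg_K HG.
Let VK := hg_VK HG.
Let Glt := hg_lt HG.
Let inv_lt := inv_lt HG.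
Let lt_inv := lt_inv HG.
Let G_cj := G_cj HG.
Let G_iter := G_iter HG.
Let G_le := G_le HG.

(* Both ends are repelling: the conjugates of an infinitesimal element by the
   powers of f are bumps between the first and the last fixed point of f. *)
Lemma repelling_ends f x1 x2 : dominates G f -> dominates (flipG G) (flip f) ->
  0 < x1 -> x1 < x2 -> x2 < 1 -> f x1 < x1 -> x2 < f x2 -> False.
Proof.
move=> D0 D1 x10 x12 x21 fx1 fx2.
have [Gf f0 _] := D0; have [_ f1 _] := D1.
have [||a [a0 ax fa Ha]] := first_fixpoint HG (x := x1) Gf f0.
- by apply/andP; split; lra.
- exact: ltW.
have {}ax : a < x1 by rewrite lt_neqAle ax andbT; apply/eqP => E; rewrite -E fa ltxx in fx1.
have [||b [b1 xb fb Hb]] := last_fixpoint HG (x := x2) Gf f1.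
- by apply/andP; split; lra.
- exact: ltW.
have {}xb : x2 < b by rewrite lt_neqAle xb andbT; apply/eqP => E; rewrite E fb ltxx in fx2.
(* As [f] fixes [r] and pushes (r, x2] up, [th n r] equals f^n (e r), which passes [x2]: the bumps
   stay large at [r]. *)
have [r [x1r rx2 fr Hr]] := fix_last HG Gf x12 (ltW fx1) fx2.
have [|e [Ge ne i0 i1 re]] := @exists_infinitesimal _ _ _ HG f f D0 D1 NC [:: (r, x2)] r.
  by apply/andP; split; lra.
have [er _] := near1 rx2 (mem_head _ _) ne; rewrite /= in er.
pose th n := cj (iter n f) e.
have Gth n : G (th n) by apply: G_cj => //; apply: G_iter.
have big : ev (fun n => x2 <= th n r).
  have [|n Hn] := @orbit_up _ _ _ HG f (e r) x2 Gf.
    by move=> z /andP[? ?]; apply: Hr; apply/andP; split; lra.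
  exists n => m nm; apply: ltW; rewrite /th (cj_iterE HG) //.
  have -> : iter m (inv f) r = r.
    by elim: m {nm} => //= m ->; apply: (inv_eq HG).
  elim: m nm => [|m IH]; first by rewrite leqn0 => /eqP E; rewrite E in Hn.
  rewrite leq_eqVlt => /orP[/eqP<-//|/IH lt] /=.
  by apply: (lt_trans fx2); rewrite Glt.
have ab : a <= b by lra.
have [g [Gg lt]] := separators HG a0 ab b1.
pose x0 := (r + x2) / 2.
have rx0 : r < x0 by rewrite /x0; lra.
have x02 : x0 < x2 by rewrite /x0; lra.
have x001 : 0 < x0 < 1 by apply/andP; split; lra.
apply: (@bumps_contra _ _ _ HG th (fun i n => g i) a b r x0 x2) => //.
- lra.
- move=> i j ij; apply: ev_true => _; apply: lt_trans (lt_trans (_ : _ < g i b) (lt _ _ ij)) _.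
    by rewrite Glt //; lra.
  by rewrite Glt //; lra.
move=> i j ij x y ax' xy yb.
have Gij := Gi (Gg j); pose u := inv (g j) (g i x); pose v := inv (g j) (g i y).
have uv : u < v by rewrite /u /v !Glt.
have cE n z : cj (inv (g i)) (cj (g j) (th n)) z = inv (g i) (g j (th n (inv (g j) (g i z)))).
  by rewrite /cj (invV HG).
suff : ev (fun n => th n u < v /\ u < th n v).
  apply: ev_mono => n [l1 l2]; rewrite !cE; split.
    by rewrite (lt_inv _ _ (Gg i)) -(inv_lt _ _ (Gg j)).
  by rewrite (inv_lt _ _ (Gg i)) -(lt_inv _ _ (Gg j)).
have g01 z : 0 < z < 1 -> 0 < inv (g j) (g i z) < 1.
  by move=> z01; do 2!apply: (G_in HG) => //.
have /andP[u0 _] := g01 x ltac:(apply/andP; split; lra).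
have /andP[_ v1] := g01 y ltac:(apply/andP; split; lra).
(* The translates of [a, b] are disjoint and ordered, so [u] and [v] lie in (0, a) or in (b, 1),
   where [th n] tends to the identity. *)
have [ltij|ltji|E] := ltngtP i j; last by [].
  have va : v < a.
    by rewrite /v lt_inv //; apply: lt_trans (lt _ _ ltij); rewrite Glt.
  by apply: (conj_to_id HG ND (a := a)) => //; lra.
have bu : b < u.
  by rewrite /u inv_lt //; apply: lt_trans (lt _ _ ltji) _; rewrite Glt.
by apply: (conj_to_id_last HG ND (b := b)) => //; lra.
Qed.

Lemma dominates_le F F' : dominates G F -> G F' ->
  (exists2 d, 0 < d & forall x, 0 < x < d -> F x <= F' x) -> dominates G F'.
Proof.
move=> [GF F0 [s Hs]] GF' [d d0 Hd].
have le h : lt0 h F -> lt0 h F'.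
  move=> [d' d'0 Hd']; exists (Num.min d d'); first by rewrite lt_min d0.
  move=> x; rewrite lt_min => /and3P[x0 xd xd'].
  by apply: lt_le_trans (Hd' x _) (Hd x _); rewrite x0.
by split=> //; [exact: le|exists s => h Gh nh; apply: le; apply: Hs].
Qed.

Lemma iter_gt t n z : G t -> (forall z, 0 < z < 1 -> z < t z) -> (0 < n)%N ->
  0 < z < 1 -> z < iter n t z.
Proof.
move=> Gt tpos; case: n => // n _ z01; elim: n => [|n IH]; first exact: tpos.
apply: (lt_trans IH); rewrite iterS; apply: tpos.
exact: (G_in HG (G_iter n.+1 Gt) z01).
Qed.

(* The bumps are the conjugates of an infinitesimal element by the powers of
   a translation t. *)
Lemma dominating_translation t : dominates G t -> dominates (flipG G) (flip (inv t)) ->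
  (forall z, 0 < z < 1 -> z < t z) -> False.
Proof.
move=> D0 D1 tpos; have [Gt _ _] := D0.
pose r : R := 1 / 2.
have r01 : 0 < r < 1 by rewrite /r; apply/andP; split; lra.
have [e [Ge _ i0 i1 re]] := exists_infinitesimal HG D0 D1 NC [::] r01.
have /andP[er0 er1] := G_in HG Ge r01; have /andP[r0 r1] := r01.
pose x0 := (r + e r) / 2.
have rx0 : r < x0 by rewrite /x0; lra.
have x0e : x0 < e r by rewrite /x0; lra.
have x01 : 0 < x0 < 1 by apply/andP; split; lra.
have ev_mul (P : nat -> Prop) k : (0 < k)%N -> ev P -> ev (fun n => P (k * n)%N).
  move=> k0 [n0 H]; exists n0 => n nn; apply: H; apply: leq_trans nn _.
  exact: leq_pmull.
apply: (@bumps_contra _ _ _ HG (fun=> e) (fun i n => iter (i * n) t) 0 1 r x0 (e r)) => //.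
- by move=> i n; apply: G_iter.
- by apply: ev_true => n; exact: lexx.
- move=> i j ij; exists 1%N => n n0.
  have -> : (j * n = i * n + (j - i) * n)%N by rewrite -mulnDl subnKC // ltnW.
  rewrite iterD (Glt (G_iter _ Gt)); apply: iter_gt => //.
  by rewrite muln_gt0 subn_gt0 ij.
move=> i j ij x y x0' xy y1.
have GtV := Gi Gt.
(* Bump [j] seen from position [i] is the conjugate of [e] by t^((j-i)n). It fades by the behaviour
   of [e] at 0 if i < j, and at 1 otherwise. *)
have [ltij|ltji|//] := ltngtP i j.
  have tlt z : 0 < z < 1 -> z < t z := tpos z.
  have k0 : (0 < j - i)%N by rewrite subn_gt0.
  have := conj_to_id HG ND Gt Ge ltr01 (lexx 1) (G1 HG Gt) tlt i0 x0' xy y1.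
  move=> /(ev_mul _ _ k0); apply: ev_mono => n.
  suff -> : cj (iter ((j - i) * n) t) e = cj (inv (iter (i * n) t)) (cj (iter (j * n) t) e) by [].
  have -> : (j * n = i * n + (j - i) * n)%N by rewrite -mulnDl subnKC // ltnW.
  apply: funext => z; rewrite /cj (invV HG) /=; last exact: G_iter.
  rewrite !(inv_iter HG) // iterD (iterK HG) //.
  by rewrite (addnC (i * n)%N) iterD (iterK HG).
have k0 : (0 < i - j)%N by rewrite subn_gt0.
have tlt z : 0 < z < 1 -> inv t z < z by move=> z01; rewrite lt_inv // tpos.
have := conj_to_id_last HG ND GtV Ge (lexx 0) ltr01 (G0 HG GtV) tlt i1 x0' xy y1.
move=> /(ev_mul _ _ k0); apply: ev_mono => n.
suff -> : cj (iter ((i - j) * n) (inv t)) e = cj (inv (iter (i * n) t)) (cj (iter (j * n) t) e) by [].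
have -> : (i * n = j * n + (i - j) * n)%N by rewrite -mulnDl subnKC // ltnW.
apply: funext => z; rewrite /cj (invV HG) /=; last exact: G_iter.
rewrite !(inv_iter HG) // (invV HG) //.
move: (j * n)%N ((i - j) * n)%N => u v.
have -> c : iter (u + v) (inv t) (iter u t c) = iter v (inv t) c.
  by rewrite addnC iterD (iterK HG).
by rewrite iterD (iterK HG).
Qed.

Lemma iter_ge t n z a : G t -> (forall z, 0 < z < a -> z < t z) -> t a = a ->
  0 < z < a -> z <= iter n t z.
Proof.
move=> Gt tpos ta /andP[z0 za]; elim: n => // n IH.
apply: (le_trans IH); rewrite iterS ltW // tpos // (lt_le_trans z0 IH) /=.
have <- : iter n t a = a by elim: n {IH} => //= n ->.
by rewrite (Glt (G_iter n Gt)).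
Qed.

(* f moves points up near both ends: a product of powers of f and of a
   conjugate of f has no fixed point and dominates f at both ends. *)
Lemma same_sign_ends f x1 : dominates G f -> dominates (flipG G) (flip (inv f)) ->
  0 < x1 < 1 -> f x1 < x1 -> False.
Proof.
move=> D0 D1 x101 fx1; have [Gf f0 _] := D0; have [_ f1 _] := D1.
have GfV := Gi Gf.
have [a [a0 ax fa Ha]] := first_fixpoint HG Gf f0 x101 (ltW fx1).
have xf : x1 <= inv f x1 by rewrite ltW // inv_lt.
have [b [b1 xb ifb Hb']] := last_fixpoint HG GfV f1 x101 xf.
have fb : f b = b by rewrite -{1}ifb VK.
have Hb z : b < z < 1 -> z < f z by move=> /Hb'; rewrite lt_inv.
have a01 : 0 < a < 1 by move: x101 => /andP[? ?]; apply/andP; split; lra.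
have b01 : 0 < b < 1 by move: x101 => /andP[? ?]; apply/andP; split; lra.
have [g Gg ga] := irr_up HG a01 b01.
pose f' := cj g f; pose a' := g a; pose b' := g b.
have Gf' : G f' by apply: G_cj.
have f'a : f' a' = a' by rewrite /f' /cj /a' /= K // fa.
have f'b : f' b' = b' by rewrite /f' /cj /b' /= K // fb.
have Ha' z : 0 < z < a' -> z < f' z.
  move=> /andP[z0 za]; rewrite /f' /cj /= -lt_inv //; apply: Ha.
  by rewrite inv_lt // (G0 HG Gg) z0 lt_inv.
have Hb'' z : b' < z < 1 -> z < f' z.
  move=> /andP[z0 za]; rewrite /f' /cj /= -lt_inv //; apply: Hb.
  by rewrite inv_lt // z0 lt_inv // (G1 HG Gg).
have ab : a <= b by lra.
have ab' : a' <= b' by rewrite /a' /b' G_le.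
have /andP[a'0 a'1] := G_in HG Gg a01; have /andP[b'0 b'1] := G_in HG Gg b01.
rewrite -/a' in a'0 a'1 ga; rewrite -/b' in b'0 b'1.
(* Since b < a', the intervals [a, b] and [a', b'] are disjoint: a power of [f'] jumps over the
   first and a power of [f] over the second. The exponent n + 1 keeps a factor [f], for comparing
   [t] with [f] near the ends. *)
have [m Hm] : exists m, b < iter m f' a.
  apply: (orbit_up HG) => // z /andP[? ?]; apply: Ha'; apply/andP; split; lra.
have [n Hn] : exists n, b' < iter n.+1 f a'.
  have [|n Hn] := @orbit_up _ _ _ HG f a' b' Gf.
    by move=> z /andP[? ?]; apply: Hb; apply/andP; split; lra.
  case: n Hn => [/= Hn|n Hn]; last by exists n.
  by have := le_lt_trans ab' Hn; rewrite ltxx.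
pose t := iter n.+1 f \o iter m f'.
have Gt : G t by apply: Gc; apply: G_iter.
have up1 k z : 0 < z < a -> z <= iter k f z by apply: iter_ge.
have up2 k z : 0 < z < a' -> z <= iter k f' z by apply: iter_ge.
have mono_up (u : R -> R) c k z : G u -> (forall z, c < z < 1 -> z < u z) -> c < z < 1 -> z <= iter k u z.
  move=> Gu Hu /andP[cz z1]; elim: k => // k IH; apply: (le_trans IH).
  rewrite iterS ltW // Hu // (lt_le_trans cz IH) /=.
  by rewrite (G_lt1 HG) //; apply: G_iter.
have up3 k z : b < z < 1 -> z <= iter k f z by apply: mono_up.
have up4 k z : b' < z < 1 -> z <= iter k f' z by apply: mono_up.
have lef z : 0 < z < 1 -> z <= iter m f' z -> f z <= iter n f (f z) -> f z <= t z.
  move=> z01 le1 le2; apply: (le_trans le2); rewrite /t /= -iterSr -iterS.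
  by rewrite G_le //; exact: (G_iter n.+1 Gf).
have near0 z : 0 < z < a -> f z <= t z.
  move=> za; have /andP[z0 z1] := za; apply: lef; first by apply/andP; split; lra.
    by apply: up2; apply/andP; split; lra.
  by apply: up1; rewrite (G_gt0 HG) // z0 -[X in _ && (_ < X)]fa Glt.
have near1 z : b' < z < 1 -> f z <= t z.
  move=> za; have /andP[z0 z1] := za; apply: lef; first by apply/andP; split; lra.
    exact: up4.
  have bz : b < z by lra.
  by apply: up3; rewrite (G_lt1 HG) // z1 andbT -{1}fb Glt.
have tpos z : 0 < z < 1 -> z < t z.
  move=> /andP[z0 z1].
  have [za|az] := ltP z a.
    apply: lt_le_trans (near0 z _); last by rewrite z0.
    by apply: Ha; rewrite z0.
  have [zb|bz] := leP z b.
    apply: (le_lt_trans zb); have zm : b < iter m f' z by apply: (lt_le_trans Hm); rewrite G_le //; apply: G_iter.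
    have zm1 : iter m f' z < 1 by rewrite (G_lt1 HG) //; apply: G_iter.
    by apply: (lt_le_trans zm); apply: up3; rewrite zm.
  have fz : z < f z by apply: Hb; rewrite bz.
  have fz2 : f z <= iter n f (f z).
    by apply: up3; rewrite (G_lt1 HG) // z1 andbT (lt_trans bz).
  have [za'|az'] := ltP z a'.
    apply: (lt_le_trans fz); apply: lef => //; first by rewrite z0.
    by apply: up2; rewrite z0.
  have [zb'|bz'] := leP z b'.
    apply: (le_lt_trans zb'); apply: (lt_le_trans Hn); rewrite /t /= -!iterS.
    rewrite G_le; last exact: (G_iter n.+1 Gf).
    have <- : iter m f' a' = a' by elim: (m) => //= k ->.
    by rewrite G_le //; apply: G_iter.
  by apply: (lt_le_trans fz); apply: near1; rewrite bz'.
apply: (@dominating_translation t) => //.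
  by apply: (dominates_le D0) => //; exists a.
have [_ fl [s Hs]] := D1.
have GtV := Gi Gt.
have le h : lt0 h (flip (inv f)) -> lt0 h (flip (inv t)).
  move=> [d d0 Hd]; pose c := Num.min d (1 - f b').
  have c0 : 0 < c by rewrite /c lt_min d0 subr_gt0 (G_lt1 HG).
  exists c => // x; rewrite /c lt_min => /and3P[x0 xd xb'].
  apply: lt_le_trans (Hd x _) _; first by rewrite x0.
  rewrite /flip lerD2l lerN2 -(G_le Gt) VK //.
  have fx : f (inv f (1 - x)) = 1 - x by rewrite VK.
  rewrite -{1}fx; apply: near1; rewrite inv_lt // lt_inv // (G1 HG Gf).
  by apply/andP; split; lra.
split; [exact: flip_in|exact: le|exists s => h Gh nh; apply: le; exact: Hs].
Qed.

End Contradictions.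

Section AltFlip.
Variables (R : realType) (N : nat) (G : set (R -> R)).
Hypothesis HG : homeo_group N G.
Implicit Types (f g h e F t : R -> R) (x y z p q : R).

(** Reflection reverses both the order of the points and the direction of motion; the sign at the
    last point, hence the parity of [k], decides whether an inverse is needed to start with a
    positive sign. *)
Lemma altp_flip f k (x : nat -> R) : G f -> altp f k x ->
  altp (if odd k then flip f else inv (flip f)) k (fun i => 1 - x (k - i)%N).
Proof.
move=> Gf [x01 xlt xs]; split=> i ik.
- have /andP[? ?] := x01 (k - i)%N (leq_subr _ _); apply/andP; split; lra.
- have := xlt (k - i.+1)%N; rewrite subnSK // => H.
  by rewrite ltrD2l ltrN2; apply: H; rewrite leq_subr.
have := xs (k - i)%N (leq_subr _ _); rewrite oddB //.
rewrite (inv_flip HG) //.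
case: (odd k); case: (odd i) => /= lt; rewrite /flip subKr ltrD2l ltrN2 //.
  by rewrite (inv_lt HG).
by rewrite (lt_inv HG).
Qed.

Lemma altp2 f a b c : 0 < a -> a < b -> b < c -> c < 1 -> a < f a -> f b < b -> c < f c ->
  altp f 2 (nth 0 [:: a; b; c]).
Proof.
by move=> a0 ab bc c1 fa fb fc; split=> [[|[|[|i]]]|[|[|i]]|[|[|[|i]]]] //= _;
  apply/andP; split; lra.
Qed.

End AltFlip.

(** * Two fixed points in a non-discrete group *)

Section TwoFixedPoints.
Variables (R : realType) (N : nat) (G : set (R -> R)).
Hypothesis HG : homeo_group N G.
Hypothesis ND : non_discrete G.
Implicit Types (f g h e F t : R -> R) (x y z p q : R).

Let Gid := hg_id HG.
Let Gc := hg_comp HG.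
Let Gi := hg_inv HG.
Let inv_lt := inv_lt HG.
Let lt_inv := lt_inv HG.
Let HF := flip_group HG.

(* A fixed point where f does not change sign is split into two sign changes
   by a small perturbation. *)
Lemma two_fix_altp f p q : G f -> f <> id -> 0 < p -> p < q -> q < 1 ->
  f p = p -> f q = q -> exists g (x : nat -> R), G g /\ altp g 2 x.
Proof.
move=> Gf fid p0 pq q1 fp fq.
have [a [a0 ap fa]] := nonfix_between HG Gf fid (lexx 0) p0 ltac:(lra).
have [b [pb bq fb]] := nonfix_between HG Gf fid (ltW p0) pq ltac:(lra).
have [c [qc c1 fc]] := nonfix_between HG Gf fid (ltW (lt_trans p0 pq)) q1 (lexx 1).
wlog fa' : f Gf fid fp fq fa fb fc / a < f a.
  move=> H; case/orP: (lt_total fa) => lt; last exact: (H f).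
  have nf z : f z != z -> inv f z != z.
    by apply: contra => /eqP E; rewrite -{1}E (hg_VK HG).
  apply: (H (inv f)) => //; rewrite ?nf ?inv_lt //; first exact: Gi.
  - exact: (inv_neq_id HG).
  - exact: (inv_eq HG).
  - exact: (inv_eq HG).
have [fb'|fb'] := orP (lt_total fb); last first.
  have [h [Gh nh hpos]] := pos_near HG ND [:: (a, f a); (b, f b)] p0 (lexx p) ltac:(lra).
  have Gk : G (inv h \o f) by apply: Gc => //; apply: Gi.
  exists (inv h \o f), (nth 0 [:: a; p; b]); split=> //; apply: altp2 => //=; try lra.
  - by rewrite inv_lt //; have [] := near1 fa' (mem_head _ _) nh.
  - by rewrite lt_inv // fp; apply: hpos; rewrite lexx.
  by rewrite inv_lt //; have [] := near1 fb' _ nh; rewrite // !inE eqxx orbT.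
have [fc'|fc'] := orP (lt_total fc); last first.
  by exists f, (nth 0 [:: a; b; c]); split=> //; apply: altp2 => //=; lra.
have q0 : 0 < q by lra.
have [h [Gh nh hpos]] := pos_near HG ND [:: (f b, b); (f c, c)] q0 (lexx q) q1.
have Gk : G (h \o f) by apply: Gc.
exists (inv (h \o f)), (nth 0 [:: b; q; c]); split; first exact: Gi.
apply: altp2 => //=; first lra.
- by rewrite inv_lt //=; have [] := near1 fb' (mem_head _ _) nh.
- by rewrite lt_inv //= fq; apply: hpos; rewrite lexx.
by rewrite inv_lt //=; have [] := near1 fc' _ nh; rewrite // !inE eqxx orbT.
Qed.

Theorem two_fix_id f p q : G f -> 0 < p -> p < q -> q < 1 -> f p = p -> f q = q -> f = id.
Proof.
move=> Gf p0 pq q1 fp fq; apply: contrapT => fid.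
have NC s : exists h1 h2,
    [/\ G h1, G h2, near_id s h1, near_id s h2 & h1 \o h2 <> h2 \o h1].
  apply: contrapT => H; apply: fid.
  apply: (commuting_two_fix HG ND (s := s) _ Gf p0 pq q1 fp fq) => h1 h2 G1 G2 n1 n2.
  by apply: contrapT => nc; apply: H; exists h1, h2.
have [g [x [Gg Hg]]] := two_fix_altp Gf fid p0 pq q1 fp fq.
have [S [f' [x' [Gf' Hf' S2 mx]]]] := altp_max HG Gg Hg.
have D0 := max_dominates HG Gf' Hf' mx.
have mxF : forall h j (y : nat -> R), flipG G h -> altp h j y -> (j <= S)%N.
  move=> h j y Gh Hh; have := altp_flip HF Gh Hh; apply: mx.
  by case: (odd j) => //; apply: Gi.
have [x01 xlt xs] := Hf'.
have /andP[a0 a1] := x01 1%N (ltnW S2); have fx1 := xs 1%N (ltnW S2).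
(* Near 0 [f'] moves points up; near 1 it moves them down if [S] is odd and up if [S] is even. *)
have := altp_flip HG Gf' Hf'; case oS : (odd S) => HfF.
  have D1 := max_dominates HF (flip_in Gf') HfF mxF.
  have /andP[b0 b1] := x01 2%N S2; have fx2 := xs 2%N S2.
  exact: (repelling_ends HG ND NC D0 D1 a0 (xlt 1%N S2) b1 fx1 fx2).
have GfV : flipG G (flip (inv f')) := flip_in (Gi Gf').
rewrite (inv_flip HG) // in HfF.
have D1 := max_dominates HF GfV HfF mxF.
by apply: (same_sign_ends HG ND NC D0 D1 (x1 := x' 1%N)) => //; rewrite a0.
Qed.

End TwoFixedPoints.

(** * Non-discreteness *)

Section Words.
Variable R : realType.
Implicit Types (x y z m M q eta : R).

Definition near_linear0 (f : R -> R) m M : Prop :=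
  [/\ 0 < m, 0 < M & exists2 d, 0 < d & forall x y, 0 < x -> x < y -> y < d ->
     m * (y - x) <= f y - f x <= M * (y - x)].

(** What the pigeonhole argument takes from C^1: near 0 the slopes of chords have ratios as close to
    1 as desired. *)
Definition tame0 (f : R -> R) : Prop :=
  forall eta, 0 < eta -> exists m M, near_linear0 f m M /\ M <= (1 + eta) * m.

Definition word (c : bool -> R -> R) (w : seq bool) : R -> R :=
  foldr (fun b g => c b \o g) id w.

Lemma word_rcons c w b : word c (rcons w b) = word c w \o c b.
Proof. by elim: w => //= b' w ->. Qed.

Lemma pow_bound eta n : 0 <= eta -> n%:R * eta <= 1 -> (1 + eta) ^+ n * (1 - n%:R * eta) <= 1.
Proof.
move=> e0; elim: n => [|n IH] le; first by rewrite expr0 mul0r subr0 mul1r.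
have n0 : 0 <= n%:R :> R by exact: ler0n.
have ne : 0 <= n%:R * eta by rewrite mulr_ge0.
rewrite -natr1 in le *.
have le' : n%:R * eta <= 1 by nra.
rewrite exprS -mulrA mulrCA; apply: le_trans (IH le').
rewrite ler_wpM2l ?exprn_ge0 ?addr_ge0 //; nra.
Qed.

Lemma geometric_dominates (C : R) : exists n, C * (4 / 3) ^+ n < 2 ^+ n.
Proof.
have bern n : 1 + n%:R / 2 <= (3 / 2 : R) ^+ n.
  elim: n => [|n IH]; first by rewrite expr0 mul0r addr0.
  have n0 : 0 <= n%:R :> R by exact: ler0n.
  rewrite exprS -natr1; nra.
exists (2 * (Num.truncn C).+1)%N; set n := (2 * _)%N.
have Cn : C < (3 / 2) ^+ n.
  apply: lt_le_trans (bern n); have := truncnS_gt C.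
  rewrite /n natrM => ?; lra.
have -> : (2 : R) ^+ n = (3 / 2) ^+ n * (4 / 3) ^+ n.
  by rewrite -exprMn; congr (_ ^+ _); field.
by rewrite ltr_pM2r // exprn_gt0 //; lra.
Qed.

Lemma min_gap (s : seq (R * R)) :
  exists2 d, 0 < d & forall p, p \in s -> p.1 < p.2 -> d <= p.2 - p.1.
Proof.
elim: s => [|a s [d d0 Hd]]; first by exists 1.
have [lt|le] := ltP a.1 a.2.
  exists (Num.min d (a.2 - a.1)); first by rewrite lt_min d0 subr_gt0.
  move=> p; rewrite inE => /orP[/eqP-> _|ps pp]; first by rewrite ge_min lexx orbT.
  by rewrite ge_min Hd.
exists d => // p; rewrite inE => /orP[/eqP->|]; last exact: Hd.
by rewrite ltNge le.
Qed.

End Words.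

(** * An interior fixed point makes the group non-discrete *)

Section NonDiscrete.
Variables (R : realType) (N : nat) (G : set (R -> R)).
Hypothesis HG : homeo_group N G.
Hypothesis tameG : forall f, G f -> tame0 f.
Implicit Types (f g h e F t : R -> R) (x y z : R).

Let Gid := hg_id HG.
Let Gc := hg_comp HG.
Let Gi := hg_inv HG.
Let K := hg_K HG.
Let VK := hg_VK HG.
Let Glt := hg_lt HG.
Let inv_lt := inv_lt HG.
Let lt_inv := lt_inv HG.
Let G_cj := G_cj HG.
Let G_iter := G_iter HG.
Let G_le := G_le HG.

Section Pigeonhole.
Variables (c : bool -> R -> R) (d m M q : R).
Hypotheses (Gcc : forall b, G (c b)) (d0 : 0 < d) (m0 : 0 < m) (M0 : 0 < M)
  (q1 : 1 <= q) (Mq : M <= q * m).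
Hypothesis c_lt : forall b x, 0 < x < d -> c b x < x.
Hypothesis c_lin : forall b x y, 0 < x -> x < y -> y < d ->
  m * (y - x) <= c b y - c b x <= M * (y - x).
Hypothesis word_inj : forall w w' : seq bool, size w = size w' ->
  word c w = word c w' -> w = w'.

Lemma G_word w : G (word c w).
Proof. by elim: w => //= b w IH; apply: Gc. Qed.

Lemma word_in w x : 0 < x < d -> 0 < word c w x <= x.
Proof.
move=> /andP[x0 xd]; elim: w => [|b w /andP[w0 wx]] /=; first by rewrite x0 /=.
rewrite (G_gt0 HG) // w0 /=; apply: (le_trans _ wx); apply/ltW/c_lt.
by rewrite w0 (le_lt_trans wx).
Qed.

Lemma word_lin w x y : 0 < x -> x < y -> y < d ->
  m ^+ size w * (y - x) <= word c w y - word c w x <= M ^+ size w * (y - x).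
Proof.
move=> x0 xy yd; elim: w => [|b w IH]; first by rewrite /= !expr0 !mul1r lexx.
have xd : 0 < x < d by rewrite x0 (lt_trans xy).
have ydd : 0 < y < d by rewrite yd (lt_trans x0).
have /andP[wx0 _] := word_in w xd; have /andP[wy0 wyy] := word_in w ydd.
have wxy : word c w x < word c w y by rewrite Glt //; apply: G_word.
have /andP[l1 l2] := c_lin b wx0 wxy (le_lt_trans wyy yd).
case/andP: IH => i1 i2; rewrite /= !exprS -!mulrA; apply/andP; split.
  by apply: le_trans l1; rewrite ler_pM2l.
by apply: (le_trans l2); rewrite ler_pM2l.
Qed.

(** The limit of [word_lin] as its left point tends to 0. *)
Lemma word_le w y : 0 < y < d -> word c w y <= M ^+ size w * y.
Proof.
move=> /andP[y0 yd]; apply/ler_addgt0Pr => eps eps0.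
pose x := Num.min eps y / 2.
have m1 : 0 < Num.min eps y by rewrite lt_min eps0.
have m2 : Num.min eps y <= eps by rewrite ge_min lexx.
have m3 : Num.min eps y <= y by rewrite ge_min lexx orbT.
have x0 : 0 < x by rewrite /x; lra.
have xy : x < y by rewrite /x; lra.
have xe : x < eps by rewrite /x; lra.
have /andP[_ up] := word_lin w x0 xy yd.
have /andP[_ wx] := word_in w (x := x) ltac:(rewrite x0 (lt_trans xy)//).
have Mx : 0 <= M ^+ size w * x by rewrite mulr_ge0 // ?exprn_ge0 // ltW.
by move: up; rewrite mulrBr => up; lra.
Qed.

(* There are 2^n words of length n, and they move finitely many points into
   cells of size m^n inside an interval of size M^n: since M/m is close to 1,
   two words agree up to one cell. *)
Lemma close_words (s : seq (R * R)) :
  (forall p, p \in s -> 0 < p.1 < d /\ 0 < p.2 < d) ->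
  q ^+ (size s).*2 <= 4 / 3 ->
  exists h, [/\ G h, h <> id & near_id s h].
Proof.
move=> sd qs; have [g g0 Hg] := min_gap s.
pose ps := unzip1 s ++ unzip2 s.
have szps : size ps = (size s).*2 by rewrite size_cat !size_map addnn.
have psd x : x \in ps -> 0 < x < d.
  by rewrite mem_cat => /orP[] /mapP[p /sd[? ?] ->].
pose C : R := d / g + 1.
have C1 : 1 <= C by rewrite /C lerDr divr_ge0 // ltW.
have q0 : 0 <= q := le_trans ler01 q1.
have C0 : 0 <= C := le_trans ler01 C1.
have [n Hn] := geometric_dominates (C ^+ size ps).
(* The least length to which a word of length [n] can shrink a gap between the points of a pair. *)
pose cell := m ^+ n * g.
have cell0 : 0 < cell by rewrite mulr_gt0 // exprn_gt0.
pose T := Num.truncn (M ^+ n * d / cell).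
have TC : T.+1%:R <= q ^+ n * C.
  have qn1 : 1 <= q ^+ n by rewrite exprn_ege1.
  have MqN : M ^+ n <= q ^+ n * m ^+ n.
    rewrite -exprMn lerXn2r // nnegrE; first exact: ltW.
    by rewrite mulr_ge0 ?(ltW m0) // (le_trans ler01).
  have le : T%:R <= q ^+ n * (d / g).
    apply: (@le_trans _ _ (M ^+ n * d / cell)).
      by rewrite truncn_le divr_ge0 ?mulr_ge0 ?exprn_ge0 // ltW.
    rewrite ler_pdivrMr // /cell.
    have -> : q ^+ n * (d / g) * (m ^+ n * g) = q ^+ n * m ^+ n * d.
      by field; rewrite gt_eqF.
    by rewrite ler_pM2r.
  by rewrite -natr1 /C mulrDr mulr1; lra.
pose idx (w : n.-tuple bool) (i : 'I_(size ps)) : 'I_T.+1 :=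
  inord (Num.truncn (word c w ps`_i / cell)).
have idx_lt (w : n.-tuple bool) x : x \in ps -> (Num.truncn (word c w x / cell) < T.+1)%N.
  move=> /psd xd; rewrite ltnS; apply: le_truncn.
  rewrite ler_pM2r ?invr_gt0 //; apply: (le_trans (word_le w xd)).
  by rewrite size_tuple ler_pM2l ?exprn_gt0 // ltW //; case/andP: xd.
have [w [w' [ww E]]] : exists w w' : n.-tuple bool, w <> w' /\
    forall x, x \in ps -> Num.truncn (word c w x / cell) = Num.truncn (word c w' x / cell).
  apply: contrapT => H.
  have inj : injective (fun w => [ffun i => idx w i]).
    move=> w w' /ffunP E; apply: contrapT => ww; apply: H; exists w, w'; split=> // x xps.
    have i_lt : (index x ps < size ps)%N by rewrite index_mem.
    have := E (Ordinal i_lt); rewrite !ffunE /idx /= nth_index // => /(congr1 val) /=.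
    by rewrite !inordK //; apply: idx_lt.
  (* With P the size of [ps], there are at most (q^n C)^P = C^P (q^P)^n <= C^P (4/3)^n profiles of
     cells, fewer than the 2^n words. *)
  have := leq_card _ inj; rewrite card_tuple card_bool card_ffun !card_ord.
  rewrite leqNgt => /negP; apply.
  rewrite -(ltr_nat R) !natrX; apply: le_lt_trans Hn.
  apply: (@le_trans _ _ ((q ^+ n * C) ^+ size ps)).
    by rewrite lerXn2r // nnegrE ?ler0n // mulr_ge0 // exprn_ge0.
  rewrite exprMn mulrC ler_pM2l; last by rewrite exprn_gt0 // (lt_le_trans ltr01).
  by rewrite exprAC szps lerXn2r // nnegrE ?exprn_ge0 //.
have close x : x \in ps -> `|word c w x - word c w' x| < cell.
  move=> xps; have /andP[x0 _] := psd _ xps.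
  have pos (v : seq bool) : 0 <= word c v x / cell.
    by rewrite divr_ge0 ?(ltW cell0) // ltW // (G_gt0 HG) //; apply: G_word.
  have /andP[a1 a2] := truncn_itv (pos w); have /andP[b1 b2] := truncn_itv (pos w').
  rewrite -E // -natr1 in b1 b2; rewrite -natr1 in a2.
  have : `|word c w x / cell - word c w' x / cell| < 1.
    by rewrite ltr_norml; apply/andP; split; lra.
  by rewrite -mulrBl normrM (gtr0_norm (_ : 0 < cell^-1)) ?invr_gt0 // ltr_pdivrMr // mul1r.
have Gw := G_word w; have Gw' := G_word w'.
exists (inv (word c w) \o word c w'); split; first by apply: Gc => //; apply: Gi.
  move=> E'; apply: ww; apply: val_inj; apply: word_inj; first by rewrite !size_tuple.
  apply: funext => x; have := congr1 (fun u => word c w (u x)) E'.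
  by rewrite /= VK.
(* Each word separates [l] from [u] by at least a cell, and the two words differ by less than a cell
   at [l]. *)
move=> [l u] psu /= lu; have gu := Hg _ psu lu; rewrite /= in gu.
have [/andP[/= l0 ld] /andP[/= u0 ud]] := sd _ psu.
have lps : l \in ps by rewrite mem_cat; apply/orP; left; apply/mapP; exists (l, u).
have ups : u \in ps by rewrite mem_cat; apply/orP; right; apply/mapP; exists (l, u).
have := close _ lps; rewrite ltr_norml => /andP[c1 c2].
have cg : cell <= m ^+ n * (u - l) by rewrite ler_pM2l // exprn_gt0.
have /andP[e1 _] := word_lin w l0 lu ud; have /andP[e2 _] := word_lin w' l0 lu ud.
rewrite size_tuple in e1; rewrite size_tuple in e2.
by rewrite lt_inv // inv_lt //; split; lra.
Qed.

End Pigeonhole.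

(** Near 1 [f] may be assumed to attract towards its last fixed point [P], and near 0 one of [f] and
    its inverse attracts towards its first fixed point [p]. A conjugation by [g] moves [p] beyond
    [P]; on [P, g p] powers of the two elements then pull towards opposite ends. *)
Lemma ping_pong f x : G f -> f <> id -> 0 < x < 1 -> f x = x ->
  exists a b l r, [/\ G a, G b, l < r & [/\ l <= a l, a r < b l & b r <= r]].
Proof.
move=> Gf fid x01 fx.
have HF := flip_group HG.
wlog f1 : f Gf fid fx / lt0 id (flip f).
  move=> H; have ffid : flip f <> id by move=> E; apply: fid; rewrite -(flipK f) E (flip_id R).
  have [lt|lt] := germ_sign HF (flip_in Gf) ffid; first exact: (H f).
  apply: (H (inv f)); [exact: Gi|exact: (inv_neq_id HG)|exact: (inv_eq HG)|].
  by rewrite -(inv_flip HG) //; apply: (lt0_invV HF) => //; apply: flip_in.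
have [|P [P1 xP fP HP]] := @last_fixpoint _ _ _ HG f x Gf f1 x01; first by rewrite fx.
have [k [Gk k0 kx]] : exists k, [/\ G k, lt0 id k & k x = x].
  have [lt|lt] := germ_sign HG Gf fid; first by exists f.
  by exists (inv f); split; [exact: Gi|exact: (lt0_invV HG)|exact: (inv_eq HG)].
have [|p [p0 px kp Hp]] := @first_fixpoint _ _ _ HG k x Gk k0 x01; first by rewrite kx.
have /andP[x0 x1] := x01.
have p01 : 0 < p < 1 by apply/andP; split; lra.
have P01 : 0 < P < 1 by apply/andP; split; lra.
have [g Gg gp] := irr_up HG p01 P01.
have /andP[gp0 gp1] := G_in HG Gg p01.
pose y := (P + g p) / 2.
have Py : P < y by rewrite /y; lra.
have yg : y < g p by rewrite /y; lra.
have [n1 H1] : exists n, iter n f (g p) < y.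
  apply: (orbit_down HG) => // z /andP[? ?]; apply: HP; apply/andP; split; lra.
have [n2 H2] : exists n, y < iter n (cj g k) P.
  apply: (orbit_up HG); first exact: G_cj.
  move=> z /andP[? ?]; rewrite /cj /= -lt_inv //; apply: Hp.
  rewrite inv_lt // (G0 HG Gg) lt_inv //; apply/andP; split; lra.
exists (iter n1 f), (iter n2 (cj g k)), P, (g p); split=> //.
- exact: G_iter.
- by apply: G_iter; apply: G_cj.
split; [|exact: lt_trans H2|].
  by elim: (n1) => //= n IH; rewrite -{1}fP G_le.
rewrite (cj_iter HG) // K //.
by have -> : iter n2 k p = p by elim: (n2) => //= n ->.
Qed.

Section PingPongWords.
Variables (a b : R -> R) (l r : R).
Hypotheses (Ga : G a) (Gb : G b) (lr : l < r) (al : l <= a l) (ab : a r < b l) (br : b r <= r).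

(** These two products have equal derivative at 0, which [a] and [b] themselves need not have. *)
Let c (i : bool) := if i then a \o b else b \o a.

(** The two letters send [l, r] into disjoint subintervals, so the image of [l] reveals the
    outermost letter. *)
Lemma pp_inj (w w' : seq bool) : size w = size w' -> word c w = word c w' -> w = w'.
Proof.
have Gcc i : G (c i) by case: i; apply: Gc.
have ar : a l < a r by rewrite Glt.
have bl : b l < b r by rewrite Glt.
have u1 : a (b r) <= a r by rewrite G_le.
have v1 : b l <= b (a l) by rewrite G_le.
have lb : l <= b l by apply/ltW/(le_lt_trans al)/(lt_trans ar).
have rr : a r <= r by apply/ltW/(lt_le_trans ab)/(le_trans (ltW bl)).
have lo i : l <= c i l.
  by case: i => /=; [apply: (le_trans al)|apply: (le_trans lb)]; rewrite /= G_le.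
have hi i : c i r <= r.
  by case: i => /=; [apply: le_trans rr|apply: le_trans br]; rewrite /= G_le.
have in_lr i x : l <= x <= r -> l <= c i x <= r.
  move=> /andP[lx xr]; apply/andP; split.
    by apply: (le_trans (lo i)); rewrite G_le.
  by apply: le_trans (hi i); rewrite G_le.
have sep x x' : l <= x <= r -> l <= x' <= r -> c true x < c false x'.
  move=> /andP[lx xr] /andP[lx' xr'].
  have : c true x <= c true r by rewrite G_le.
  have : c false l <= c false x' by rewrite G_le.
  move=> c1 c2; apply: (le_lt_trans c2); apply: (lt_le_trans _ c1).
  by apply: (le_lt_trans u1); apply: (lt_le_trans ab).
have w_in v : l <= word c v l <= r by elim: v => [|i v IH] /=; [rewrite lexx ltW|exact: in_lr].
elim: w w' => [|i w IH] [|j w'] //= [sz] E.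
have ij : i = j.
  have : c i (word c w l) = c j (word c w' l) := congr1 (fun u => u l) E.
  case: (i) (j) => [] [] // E'.
    by have := sep _ _ (w_in w) (w_in w'); rewrite E' ltxx.
  by have := sep _ _ (w_in w') (w_in w); rewrite E' ltxx.
rewrite -ij in E *; congr cons; apply: IH => //.
apply: funext => x; apply: (G_inj HG (Gcc i)).
exact: (congr1 (fun u => u x) E).
Qed.

End PingPongWords.

Lemma near_linear0_comp f g m m' M M' : G g -> near_linear0 f m M -> near_linear0 g m' M' ->
  near_linear0 (f \o g) (m * m') (M * M').
Proof.
move=> Gg [m0 M0 [d d0 Hd]] [m'0 M'0 [d' d'0 Hd']].
split; [exact: mulr_gt0|exact: mulr_gt0|].
exists (Num.min (inv g d) d'); first by rewrite lt_min inv_lt // (G0 HG Gg) d0.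
move=> x y x0 xy; rewrite lt_min => /andP[y1 y2].
have /andP[l1 l2] := Hd' _ _ x0 xy y2.
have /andP[l3 l4] := Hd (g x) (g y) ltac:(rewrite (G_gt0 HG)//) ltac:(rewrite Glt//)
  ltac:(rewrite -inv_lt//).
rewrite -!mulrA /=; apply/andP; split.
  by apply: le_trans l3; rewrite ler_pM2l.
by apply: (le_trans l4); rewrite ler_pM2l.
Qed.

(* Conjugating into a neighbourhood of 0 where both words in a and b contract
   almost linearly and with the same rate. *)
Lemma nd_contracting a b s : G a -> G b -> lt0 (a \o b) id ->
  (forall w w' : seq bool, size w = size w' ->
     word (fun i : bool => if i then a \o b else b \o a) w =
     word (fun i : bool => if i then a \o b else b \o a) w' -> w = w') ->
  exists h, [/\ G h, h <> id & near_id s h].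
Proof.
move=> Ga Gb ab0 inj.
have ba0 : lt0 (b \o a) id.
  have := lt0_l HG Gb (lt0_r HG (Gi Gb) ab0).
  by congr lt0; apply: funext => x /=; rewrite ?VK.
(* The group fixes every point outside (0, 1), so the discarded pairs give conditions that hold
   automatically. *)
pose s' := [seq p <- s | (0 < p.1 < 1) && (0 < p.2 < 1)].
pose k := (size s').*2.
(* Then 2k eta <= 1/4 and [pow_bound] gives (1 + eta)^(2k) <= 4/3; the factor 2 comes from the two
   maps in each letter. *)
pose eta : R := 1 / (8 * k.+1%:R).
have k0 : 0 < k.+1%:R :> R by rewrite ltr0n.
have eta0 : 0 < eta by rewrite divr_gt0 // mulr_gt0.
have keta : (2 * k)%:R * eta <= 1 / 4.
  rewrite /eta mulrA mulr1 ler_pdivrMr ?mulr_gt0 // natrM -natr1.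
  have : 0 <= k%:R :> R by exact: ler0n.
  lra.
have [ma [Ma [La ea]]] := tameG Ga eta0; have [mb [Mb [Lb eb]]] := tameG Gb eta0.
have [m0 M0 [d1 d10 Hd1]] := near_linear0_comp Gb La Lb.
have [_ _ [d2 d20 Hd2]] := near_linear0_comp Ga Lb La.
have [d3 d30 Hd3] := ab0; have [d4 d40 Hd4] := ba0.
pose d := Num.min (Num.min d1 d2) (Num.min (Num.min d3 d4) (1 / 2)).
have d0 : 0 < d by rewrite /d !lt_min d10 d20 d30 d40 /=; lra.
have dle x : x < d -> [/\ x < d1, x < d2, x < d3, x < d4 & x < 1 / 2].
  by rewrite /d !lt_min => /andP[/andP[? ?] /andP[/andP[? ?] ?]].
have [g Gg Hg] : exists2 g, G g & forall p, p \in s' -> g p.1 < d /\ g p.2 < d.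
  have [c c01 Hc] : exists2 c, 0 < c < 1 & forall p, p \in s' -> p.1 <= c /\ p.2 <= c.
    have : all (fun p : R * R => (0 < p.1 < 1) && (0 < p.2 < 1)) s' by exact: filter_all.
    elim: s' {k eta k0 eta0 keta ea eb} => [|p t IH] /=.
      by exists (1 / 2); [apply/andP; split; lra|].
    move=> /andP[/andP[/andP[a1 a2] /andP[b1 b2]] /IH[c /andP[c0 c1] Hc]].
    exists (Num.max c (Num.max p.1 p.2)); first by rewrite !gt_max !lt_max c0 c1 a2 b2.
    move=> p'; rewrite inE !le_max => /orP[/eqP->|/Hc[-> ->] //].
    by rewrite !lexx !orbT.
  have d01 : 0 < d < 1.
    rewrite d0 /=; have : d <= 1 / 2 by rewrite /d !ge_min lexx !orbT.
    by move=> ?; lra.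
  have [g Gg lt] := irr_down HG c01 d01; exists g => // p /Hc[? ?].
  by split; apply: le_lt_trans lt; rewrite G_le.
pose s2 := [seq (g p.1, g p.2) | p <- s'].
have [|||||||h [Gh hid nh]] := @close_words (fun i : bool => if i then a \o b else b \o a)
    d (ma * mb) (Ma * Mb) ((1 + eta) ^+ 2) _ d0 m0 M0 _ _ _ _ inj s2.
- by case; apply: Gc.
- by rewrite exprn_ege1 // lerDl ltW.
- have [ma0 Ma0 _] := La; have [mb0 Mb0 _] := Lb.
  rewrite expr2 mulrACA; apply: ler_pM => //; exact: ltW.
- move=> i x /andP[x0 /dle[? ? x3 x4 _]]; case: i => /=.
    by apply: Hd3; rewrite x0.
  by apply: Hd4; rewrite x0.
- move=> i x y x0 xy /dle[y1 y2 _ _ _]; case: i; first exact: Hd1.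
  by rewrite (mulrC ma) (mulrC Ma); apply: Hd2.
- move=> _ /mapP[p ps ->] /=; have [-> ->] := Hg _ ps.
  move: ps; rewrite mem_filter => /andP[/andP[/andP[a1 _] /andP[b1 _]] _].
  by rewrite !(G_gt0 HG) // a1 b1.
- rewrite size_map -/k -exprM.
  have := pow_bound (n := (2 * k)%N) (ltW eta0) ltac:(lra).
  have : 0 < (1 + eta) ^+ (2 * k) by rewrite exprn_gt0 //; lra.
  by move=> ? ?; nra.
have nh' : near_id s' (cj (inv g) h).
  move=> p ps pp; have lt : g p.1 < g p.2 by rewrite Glt.
  have ms : (g p.1, g p.2) \in s2 by apply/mapP; exists p.
  have [n1 n2] := near1 lt ms nh.
  by rewrite /cj (invV HG) //= lt_inv // inv_lt.
have Gk : G (cj (inv g) h) by apply: G_cj => //; apply: Gi.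
exists (cj (inv g) h); split=> //; first by apply: (cj_neq_id HG) => //; apply: Gi.
move=> p ps pp.
have out x : ~~ (0 < x < 1) -> cj (inv g) h x = x by exact: (hg_out HG).
have [p1|n1] := boolP (0 < p.1 < 1); have [p2|n2] := boolP (0 < p.2 < 1).
- by apply: nh' => //; rewrite mem_filter p1 p2.
- rewrite (out _ n2); split=> //; have /andP[? lt1] := G_in HG Gk p1.
  apply: (lt_le_trans lt1); rewrite leNgt; apply: contra n2 => ->; rewrite andbT.
  by case/andP: p1 => p1 _; apply: lt_trans pp.
- rewrite (out _ n1); split=> //; have /andP[gt0 _] := G_in HG Gk p2.
  apply: le_lt_trans gt0; rewrite leNgt; apply: contra n1 => -> /=.
  by case/andP: p2 => _; apply: lt_trans.
by rewrite (out _ n1) (out _ n2).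
Qed.

Theorem fix_non_discrete f x : G f -> f <> id -> 0 < x < 1 -> f x = x -> non_discrete G.
Proof.
move=> Gf fid x01 fx s.
have [a [b [l [r [Ga Gb lr [al ab br]]]]]] := ping_pong Gf fid x01 fx.
pose c (i : bool) := if i then a \o b else b \o a.
have inj := pp_inj Ga Gb lr al ab br.
have uid : a \o b <> id.
  move=> E; have E' : a (b r) = r := congr1 (fun u => u r) E.
  have : a (b r) <= a r by rewrite G_le.
  have : b l < b r by rewrite Glt.
  by lra.
have [lt|lt] := germ_sign HG (Gc Ga Gb) uid; last exact: nd_contracting lt inj.
(* If the products expand near 0, their inverses contract. The inverses need not preserve [l, r], so
   injectivity is inherited by inverting and reversing words. *)
have Ec (i : bool) : (if i then inv b \o inv a else inv a \o inv b) = inv (c i).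
  by case: i; rewrite /c (inv_comp HG).
apply: (@nd_contracting (inv b) (inv a)); [exact: Gi|exact: Gi| |].
  by rewrite -(inv_comp HG) //; apply: (lt0_inv HG) => //; apply: Gc.
have Gcc i : G (c i) by case: i; apply: Gc.
have wordV w : word (fun i : bool => if i then inv b \o inv a else inv a \o inv b) w =
    inv (word c (rev w)).
  elim: w => [|i w IH]; first by rewrite /= (inv_id HG).
  by rewrite /= rev_cons word_rcons (inv_comp HG) ?IH ?Ec //; apply: G_word.
move=> w w' sz; rewrite !wordV => /(congr1 (@inv R)).
rewrite !(invV HG); try exact: G_word.
move=> /inj; rewrite !size_rev => /(_ sz) /(congr1 rev).
by rewrite !revK.
Qed.

End NonDiscrete.

(** * Extension to the real line *)

Section Extension.
Variable R : realType.
Implicit Types (f g : unit_itv R -> unit_itv R) (x y z : R) (i j : unit_itv R).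

Fact mem0 : (0 : R) \in unit_itv R.
Proof. by rewrite mem_setE in_itv /= lexx ler01. Qed.

Definition zero_pt : unit_itv R := exist _ 0 mem0.

Definition to_itv x : unit_itv R := insubd zero_pt x.

Definition ext f x : R := if 0 <= x <= 1 then pt (f (to_itv x)) else x.

Lemma pt_itv i : 0 <= pt i <= 1.
Proof. by have : val i \in (`[0, 1] : interval R) := set_mem (valP i); rewrite in_itv. Qed.

Lemma to_itvK x : 0 <= x <= 1 -> pt (to_itv x) = x.
Proof.
move=> x01; have xI : x \in unit_itv R by rewrite mem_setE in_itv.
by rewrite /pt val_insubd xI.
Qed.

Lemma pt_inj : injective (@pt R).
Proof. exact: val_inj. Qed.

Lemma to_itv_pt i : to_itv (pt i) = i.
Proof. by apply: pt_inj; rewrite to_itvK // pt_itv. Qed.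

Lemma ext_pt f i : ext f (pt i) = pt (f i).
Proof. by rewrite /ext pt_itv to_itv_pt. Qed.

Lemma ext_in f x : 0 <= x <= 1 -> 0 <= ext f x <= 1.
Proof. by move=> x01; rewrite /ext x01 pt_itv. Qed.

Lemma ext_comp f g : ext (f \o g) = ext f \o ext g.
Proof.
apply: funext => x /=; rewrite {1 3}/ext; case: ifPn => x01.
  by rewrite ext_pt.
by rewrite /ext (negbTE x01).
Qed.

Lemma ext_id : ext id = id.
Proof. by apply: funext => x; rewrite /ext; case: ifPn => // /to_itvK. Qed.

Lemma ext_inj f g : ext f = ext g -> f = g.
Proof. by move=> E; apply: funext => i; apply: pt_inj; rewrite -!ext_pt E. Qed.

Lemma ext_cancel f g : cancel f g -> cancel (ext f) (ext g).
Proof.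
move=> fg x; have -> : ext g (ext f x) = ext (g \o f) x by rewrite ext_comp.
by have -> : g \o f = id by [apply: funext => i /=; rewrite fg]; rewrite ext_id.
Qed.

Lemma inv_ext f g : mutually_inverse f g -> inv (ext f) = ext g.
Proof.
move=> [fg gf]; apply: funext => y; rewrite /inv.
have /= E := xgetPex 0 (ex_intro [set x | ext f x = y] (ext g y) (ext_cancel gf y)).
by rewrite -{2}E (ext_cancel fg).
Qed.

Lemma ext_fix f i : pt i = 0 \/ pt i = 1 -> orientation_preserving f ->
  (exists g, mutually_inverse f g) -> f i = i.
Proof.
move=> i01 fi [g [fg gf]]; have g_lt a b : pt (g a) < pt (g b) -> pt a < pt b.
  by move=> /fi; rewrite !gf.
have /andP[a0 a1] := pt_itv (f i); have /andP[b0 b1] := pt_itv (g i).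
apply: pt_inj; case: i01 => E.
  have [lt|le] := ltP (pt i) (pt (f i)); last lra.
  have [lt'|le'] := ltP (pt i) (pt (g i)).
    by have := fi _ _ lt'; rewrite gf; lra.
  have : g i = i by apply: pt_inj; lra.
  by move=> E'; rewrite -{1}E' gf.
have [lt|le] := ltP (pt (f i)) (pt i); last lra.
have [lt'|le'] := ltP (pt (g i)) (pt i).
  by have := fi _ _ lt'; rewrite gf; lra.
have : g i = i by apply: pt_inj; lra.
by move=> E'; rewrite -{1}E' gf.
Qed.

Lemma has_deriv_dist f i (l : R) : has_deriv f i l -> forall e, 0 < e ->
  exists2 d, 0 < d & forall j, j <> i -> `|pt j - pt i| < d ->
    `|(pt (f j) - pt (f i)) / (pt j - pt i) - l| < e.
Proof.
move=> /cvgrPdist_lt H e e0; have := H e e0.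
move=> /nbhs_ballP[d /= d0 Hd]; exists d => // j ji jd.
rewrite distrC; apply: (Hd j); last exact/eqP.
by rewrite /= -initial_ballE /= /ball /= distrC.
Qed.

Lemma ext_is_derive f x (df : unit_itv R -> R) :
  (forall i, has_deriv f i (df i)) -> 0 < x < 1 ->
  is_derive x 1 (ext f) (df (to_itv x)).
Proof.
move=> H /andP[x0 x1]; set l := df _.
have xE : pt (to_itv x) = x by rewrite to_itvK // !ltW.
suff D : (h^-1 *: (ext f (h *: 1 + x) - ext f x)) @[h --> 0^'] --> l.
  split; first by apply/cvg_ex; exists l.
  by apply/cvg_lim.
apply/cvgrPdist_lt => e e0.
have [d d0 Hd] := has_deriv_dist (H (to_itv x)) e0.
apply/nbhs_ballP; exists (Num.min d (Num.min x (1 - x))) => /=.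
  by rewrite !lt_min d0 x0 subr_gt0.
move=> h; rewrite /ball /= sub0r normrN !lt_min => /and3P[hd hx hx1] h0.
move: hx hx1; rewrite !ltr_norml => /andP[? ?] /andP[? ?].
have y01 : 0 <= h + x <= 1 by apply/andP; split; lra.
have yE := to_itvK y01.
have hE : h *: 1 = h by rewrite /GRing.scale /= mulr1.
have ne : to_itv (h + x) <> to_itv x.
  move=> /(congr1 (@pt R)); rewrite xE yE => E.
  by move/eqP: h0; apply; lra.
have hd' : `|pt (to_itv (h + x)) - pt (to_itv x)| < d by rewrite yE xE addrK.
have := Hd _ ne hd'; rewrite yE xE addrK.
have x01 : 0 <= x <= 1 by rewrite !ltW.
rewrite hE distrC /ext y01 x01.
have -> (a : R) : h^-1 *: a = a / h by rewrite /GRing.scale /= mulrC.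
by rewrite ltr_norml.
Qed.

(** Strict differentiability at 0, by the mean value theorem and continuity of the derivative at
    0. *)
Lemma ext_strict_deriv f : C1 f -> exists l, forall e, 0 < e ->
  exists2 d, 0 < d & forall x y, 0 < x -> x < y -> y < d ->
    (l - e) * (y - x) <= ext f y - ext f x <= (l + e) * (y - x).
Proof.
move=> [df cdf H]; exists (df zero_pt) => e e0.
have := cdf zero_pt; move=> /cvgrPdist_lt /(_ e e0) /nbhs_ballP[d /= d0 Hd].
exists (Num.min d 1); first by rewrite lt_min d0 ltr01.
move=> x y x0 xy; rewrite lt_min => /andP[yd y1].
have der z : x <= z <= y -> is_derive z 1 (ext f) (df (to_itv z)).
  by move=> /andP[z1 z2]; apply: ext_is_derive => //; apply/andP; split; lra.
have derI (z : R) : z \in (`]x, y[ : interval R) -> is_derive z 1 (ext f) (df (to_itv z)).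
  by rewrite in_itv /= => /andP[z1 z2]; apply: der; apply/andP; split; exact: ltW.
have cont : {within `[x, y], continuous (ext f)}.
  apply: derivable_within_continuous => z; rewrite in_itv /= => zxy.
  by have [] := der z zxy.
have [z] := MVT xy derI cont.
rewrite in_itv /= => /andP[xz zy] ->.
have z01 : 0 <= z <= 1 by apply/andP; split; lra.
have : `|df zero_pt - df (to_itv z)| < e.
  apply: Hd; rewrite -initial_ballE /= /ball /= distrC.
  have -> : set_val (to_itv z) = z by exact: to_itvK.
  by rewrite subr0 gtr0_norm; lra.
rewrite ltr_norml => /andP[l1 l2].
by rewrite !ler_pM2r ?subr_gt0 //; apply/andP; split; lra.
Qed.

Lemma ext_tame f g : orientation_preserving f -> mutually_inverse f g -> C1 f -> C1 g ->
  tame0 (ext f).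
Proof.
move=> fi [fg gf] /ext_strict_deriv[l Hl] /ext_strict_deriv[m Hm].
have flt x y : 0 <= x -> x < y -> y <= 1 -> ext f x < ext f y.
  move=> x0 xy y1; have x01 : 0 <= x <= 1 by apply/andP; split; lra.
  have y01 : 0 <= y <= 1 by apply/andP; split; lra.
  by rewrite /ext x01 y01; apply: fi; rewrite !to_itvK.
have f0 : ext f 0 = 0.
  have := ext_pt f zero_pt; rewrite (@ext_fix f zero_pt) //; [by left|by exists g].
(* If l <= 0, the Lipschitz inverse of f could not undo f near 0. *)
have l0 : 0 < l.
  rewrite ltNge; apply/negP => l0; pose e : R := 1 / (2 * (`|m| + 1)).
  have m1 : 0 < `|m| + 1 by rewrite ltr_wpDl.
  have e0 : 0 < e by rewrite divr_gt0 // mulr_gt0.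
  have [d1 d10 Hd1] := Hl e e0; have [d2 d20 Hd2] := Hm 1 ltr01.
  pose t := Num.min d2 (1 / 2).
  have t0 : 0 < t by rewrite lt_min d20 divr_gt0.
  have td : t <= d2 by rewrite ge_min lexx.
  have t1 : t <= 1 / 2 by rewrite ge_min lexx orbT.
  have t01 : 0 <= t <= 1 by apply/andP; split; lra.
  have /andP[gt0 gt1] := ext_in g t01.
  have {}gt0 : 0 < ext g t.
    rewrite lt_neqAle gt0 andbT; apply/eqP => E.
    by have := ext_cancel gf t; rewrite -E f0 => E'; rewrite -E' ltxx in t0.
  pose d := Num.min 1 (Num.min d1 (ext g t)).
  have d0 : 0 < d by rewrite !lt_min ltr01 d10.
  have dd1 : d <= d1 by rewrite !ge_min lexx !orbT.
  have d_1 : d <= 1 by rewrite !ge_min lexx.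
  have dt : d <= ext g t by rewrite !ge_min lexx !orbT.
  pose x := d / 4; pose y := d / 2.
  have x0 : 0 < x by rewrite /x; lra.
  have xy : x < y by rewrite /x /y; lra.
  have yd : y < d by rewrite /y; lra.
  have /andP[_ u1] := Hd1 x y x0 xy (lt_le_trans yd dd1).
  have fx0 : 0 < ext f x by rewrite -f0; apply: flt => //; lra.
  have fxy : ext f x < ext f y by apply: flt; lra.
  have fy : ext f y < d2.
    apply: lt_le_trans td; rewrite -[ltRHS](ext_cancel gf t).
    by apply: flt; lra.
  have /andP[_ u2] := Hd2 _ _ fx0 fxy fy.
  rewrite !(ext_cancel fg) in u2.
  have lm : m <= `|m| := ler_norm m.
  have fd : ext f y - ext f x <= e * (y - x) by nra.
  have : (m + 1) * (ext f y - ext f x) <= (`|m| + 1) * (e * (y - x)).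
    apply: (@le_trans _ _ ((`|m| + 1) * (ext f y - ext f x))).
      by rewrite ler_pM2r ?subr_gt0 // lerD2r.
    by rewrite ler_pM2l.
  have -> : (`|m| + 1) * (e * (y - x)) = (y - x) / 2.
    by rewrite /e; field; rewrite gt_eqF.
  lra.
(* The solution of (1 + eta)(l - e) = l + e. *)
move=> eta eta0; pose e := l * (eta / (2 + eta)).
have q0 : 0 < eta / (2 + eta) by rewrite divr_gt0 // addr_gt0.
have q1 : eta / (2 + eta) < 1 by rewrite ltr_pdivrMr ?addr_gt0 //; lra.
have e0 : 0 < e by rewrite mulr_gt0.
have el : e < l by rewrite -[ltRHS]mulr1 ltr_pM2l.
exists (l - e), (l + e); split; first by split; [lra|lra|exact: Hl].
have -> : (1 + eta) * (l - e) = l + e.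
  by rewrite /e; field; rewrite gt_eqF // addr_gt0.
by [].
Qed.

End Extension.

(** * Transfer to subgroups of diffeomorphisms *)

Section MainTheorem.
Variables (R : realType) (N : nat) (Gamma : set (unit_itv R -> unit_itv R)).
Hypothesis hGamma : subgroup_Diff_plus Gamma.
Hypothesis hirr : irreducible Gamma.
Hypothesis hfix : forall f, Gamma f -> f <> id -> (interior_fixpoints f #<= `I_N)%card.
Implicit Types (f g : unit_itv R -> unit_itv R).

Let G : set (R -> R) := [set ext f | f in Gamma].

Lemma ext_lt f : Gamma f -> {mono (ext f) : x y / x < y}.
Proof.
have [sD _ _ ginv] := hGamma.
move=> Gf; have [g Gg [fg gf]] := ginv f Gf; have [_ fi] := sD f Gf.
apply: leW_mono; apply: le_mono => x y xy.
have fx z : 0 <= z <= 1 -> 0 <= ext f z <= 1 by exact: ext_in.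
have out z : ~~ (0 <= z <= 1) -> ext f z = z by rewrite /ext => /negbTE ->.
have [x01|x01] := boolP (0 <= x <= 1); have [y01|y01] := boolP (0 <= y <= 1).
- by rewrite /ext x01 y01; apply: fi; rewrite !to_itvK.
- rewrite (out y) //; have /andP[_ f1] := fx x x01; apply: (le_lt_trans f1).
  rewrite ltNge; apply: contra y01 => ->; rewrite andbT.
  by case/andP: x01 => x0 _; apply: ltW; apply: le_lt_trans xy.
- rewrite (out x) //; have /andP[f0 _] := fx y y01; apply: lt_le_trans f0.
  rewrite ltNge; apply: contra x01 => -> /=.
  by case/andP: y01 => _ y1; apply: ltW; apply: lt_le_trans y1.
by rewrite !out.
Qed.

Lemma many_fixpoints f (x : nat -> R) : Gamma f ->
  (forall i, (i <= N)%N -> 0 < x i < 1 /\ ext f (x i) = x i) ->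
  (forall i, (i < N)%N -> x i < x i.+1) -> f = id.
Proof.
move=> Gf Hx xlt; apply: contrapT => fid.
have lt i j : (i < j)%N -> (j <= N)%N -> x i < x j.
  elim: j => // j IH; rewrite ltnS leq_eqVlt => /orP[/eqP-> jN|ij jN]; first exact: xlt.
  by apply: lt_trans (IH ij (ltnW jN)) _; apply: xlt.
have xK i : (i <= N)%N -> pt (to_itv (x i)) = x i.
  by move=> /Hx[/andP[? ?] _]; apply: to_itvK; rewrite !ltW.
have inj : {in `I_N.+1 &, injective (fun i => to_itv (x i))}.
  move=> i j; rewrite !inE /= => iN jN /(congr1 (@pt R)); rewrite !xK // => E.
  have [ij|ij|//] := ltngtP i j.
    by have := lt i j ij jN; rewrite E ltxx.
  by have := lt j i ij iN; rewrite E ltxx.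
have sub : (fun i => to_itv (x i)) @` `I_N.+1 `<=` interior_fixpoints f.
  move=> _ [i iN <-]; have [x01 fx] := Hx i iN.
  split; first by rewrite /interior_pt /= xK.
  by apply: pt_inj; rewrite /= -ext_pt xK.
have := hfix Gf fid => /(card_le_trans (subset_card_le sub)).
by rewrite (card_le_eql (inj_card_eq inj)) card_le_II ltnn.
Qed.

Lemma ext_group : homeo_group N G.
Proof.
have [sD g1 gc ginv] := hGamma.
split.
- by exists id => //; rewrite ext_id.
- move=> _ _ [f Gf <-] [g Gg <-]; exists (f \o g); [exact: gc|exact: ext_comp].
- move=> _ [f Gf <-]; have [g Gg fg] := ginv f Gf.
  by exists g => //; rewrite (inv_ext fg).
- move=> _ [f Gf <-]; have [g Gg fg] := ginv f Gf.
  by rewrite (inv_ext fg); apply: ext_cancel; case: fg.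
- move=> _ [f Gf <-]; have [g Gg fg] := ginv f Gf.
  by rewrite (inv_ext fg); apply: ext_cancel; case: fg.
- by move=> _ [f Gf <-]; exact: ext_lt.
- move=> _ x [f Gf <-] x01; have [g Gg fg] := ginv f Gf; have [_ fi] := sD f Gf.
  have [x01'|/negbTE E] := boolP (0 <= x <= 1); last by rewrite /ext E.
  rewrite -{2}(to_itvK x01') /ext x01'; congr pt; apply: ext_fix => //; last by exists g.
  rewrite to_itvK //; case/andP: x01' => x0 x1; move: x01.
  by rewrite !lt_neqAle x0 x1 !andbT negb_and !negbK => /orP[/eqP<-|/eqP->]; [left|right].
- move=> x x01; have /andP[x0 x1] := x01.
  have xK : pt (to_itv x) = x by rewrite to_itvK // !ltW.
  apply: contrapT => H; apply: hirr; exists (to_itv x); first by rewrite /interior_pt xK.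
  move=> f Gf; apply: pt_inj; rewrite -ext_pt xK; apply: contrapT => /eqP fx.
  by apply: H; exists (ext f) => //; exists f.
move=> _ x [f Gf <-] Hx xlt.
by rewrite (many_fixpoints Gf Hx xlt) ext_id.
Qed.

Lemma ext_group_tame F : G F -> tame0 F.
Proof.
have [sD _ _ ginv] := hGamma.
move=> [f Gf <-]; have [g Gg fg] := ginv f Gf.
have [[C1f _] fi] := sD f Gf; have [[C1g _] _] := sD g Gg.
exact: ext_tame fi fg C1f C1g.
Qed.

Lemma at_most_one_fixpoint f : Gamma f -> f <> id ->
  (interior_fixpoints f #<= `I_1)%card.
Proof.
move=> Gf fid; have GF : G (ext f) by exists f.
have Fid : ext f <> id by rewrite -(ext_id R) => /ext_inj.
have ND i : interior_fixpoints f i -> non_discrete G.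
  by move=> [i01 fi]; apply: (fix_non_discrete ext_group ext_group_tame GF Fid i01); rewrite ext_pt fi.
have lt_false i j : interior_fixpoints f i -> interior_fixpoints f j -> pt i < pt j -> False.
  move=> Hi Hj ij; apply: Fid; have [/andP[i0 _] fi] := Hi; have [/andP[_ j1] fj] := Hj.
  apply: (two_fix_id ext_group (ND i Hi) GF i0 ij j1); by rewrite ext_pt ?fi ?fj.
have uniq i j : interior_fixpoints f i -> interior_fixpoints f j -> i = j.
  move=> Hi Hj; apply: pt_inj; have [ij|ji|//] := ltgtP (pt i) (pt j).
    by case: (lt_false i j).
  by case: (lt_false j i).
(* A set with at most one element is injected into [I_1] by the constant map. *)
have inj : {in interior_fixpoints f &, injective (fun=> 0%N)}.
  by move=> i j; rewrite !inE => Hi Hj _; exact: uniq.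
rewrite -(card_le_eql (inj_card_eq inj)); apply: subset_card_le.
by move=> _ [i _ <-].
Qed.

End MainTheorem.

Theorem mainTheorem2 (R : realType) (N : nat) (hN : (2 <= N)%N)
  (Gamma : set (unit_itv R -> unit_itv R))
  (hGamma : subgroup_Diff_plus Gamma)
  (hirr : irreducible Gamma)
  (hfix : forall f, Gamma f -> f <> id -> interior_fixpoints f #<= `I_N) :
  forall f, Gamma f -> f <> id -> interior_fixpoints f #<= `I_1.
Proof. by move=> f; exact: at_most_one_fixpoint hGamma hirr hfix f. Qed.
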